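(* Let $G$ be a Bieberbach group such that the first homology group $H_1(G,\mathbb{Z})=G/[G,G]$ is finite. Then $G$ is not connective.
   Context: A crystallographic group of dimension $k\ge 1$ is a discrete cocompact subgroup of $\mathrm{Iso}(\mathbb{R}^k)=\mathbb{R}^k\rtimes O(k)$; a Bieberbach group is a torsion-free crystallographic group. Such a group is virtually abelian, hence amenable. Connectivity: a separable nuclear $C^*$-algebra $A$ is called connective if there is an injective $*$-homomorphism $A\to \prod_{n} B_n/\bigoplus_n B_n$, where $B_n=C_0((0,1],M_n(\mathbb{C}))$ is the $C^*$-algebra of continuous functions from $[0,1]$ to $M_n(\mathbb{C})$ vanishing at $0$, $\prod_n B_n$ denotes the $C^*$-algebra of bounded sequences and $\bigoplus_n B_n$ the ideal of sequences converging to $0$ in norm. A countable discrete amenable group $G$ is called connective if the kernel $I(G)$ of the trivial representation $\iota:C^*(G)\to\mathbb{C}$ is a connective $C^*$-algebra. *)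

(* Defs.v *)
From HB Require Import structures.
From mathcomp Require Import all_boot all_order all_algebra.
From mathcomp Require Import generic_quotient finmap.
From mathcomp.real_closed Require Import complex.
From mathcomp Require Import all_classical all_reals all_analysis.

Set Implicit Arguments.
Unset Strict Implicit.
Unset Printing Implicit Defensive.

Import Order.TTheory GRing.Theory Num.Theory.
Import numFieldNormedType.Exports.
Import ComplexField.Normc.

Local Open Scope classical_set_scope.
Local Open Scope ring_scope.

Local Notation conjC := (@Num.conj _).

(* *-algebras over C = R[i], not assumed to be unital (the library has no
   structure for rings without unit). *)
HB.mixin Record Lmodule_isStarAlgebra (R : realType) A
    of GRing.Lmodule R[i] A := {
  amul : A -> A -> A;
  astar : A -> A;
  amulA : associative amul;
  amulDl : left_distributive amul +%R;
  amulDr : right_distributive amul +%R;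
  amulZl : forall (c : R[i]) x y, amul (c *: x) y = c *: amul x y;
  amulZr : forall (c : R[i]) x y, amul x (c *: y) = c *: amul x y;
  astarK : involutive astar;
  astarD : {morph astar : x y / x + y};
  astarZ : forall (c : R[i]) x, astar (c *: x) = c^* *: astar x;
  astarM : forall x y, astar (amul x y) = amul (astar y) (astar x)
}.
#[short(type="starAlgType")]
HB.structure Definition StarAlgebra (R : realType) :=
  {A of GRing.Lmodule R[i] A & Lmodule_isStarAlgebra R A}.

(* A *-algebra with a submultiplicative C*-seminorm: its completion is a
   C*-algebra. *)
HB.mixin Record StarAlgebra_isPreCstar (R : realType) A
    of StarAlgebra R A := {
  snorm : A -> R;
  snorm_ge0 : forall x, 0 <= snorm x;
  snormD : forall x y, snorm (x + y) <= snorm x + snorm y;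
  snormZ : forall (c : R[i]) x, snorm (c *: x) = normc c * snorm x;
  snormM : forall x y, snorm (amul x y) <= snorm x * snorm y;
  snorm_cstar : forall x, snorm (amul (astar x) x) = snorm x ^+ 2
}.
#[short(type="preCstarType")]
HB.structure Definition PreCstar (R : realType) :=
  {A of StarAlgebra R A & StarAlgebra_isPreCstar R A}.

Section StarAlgTheory.
Variables (R : realType) (A : starAlgType R).
Implicit Types x y : A.

Lemma astar0 : astar (0 : A) = 0.
Proof. by apply: (addrI (astar 0)); rewrite -astarD !addr0. Qed.
Lemma amul0l x : amul 0 x = 0.
Proof. by apply: (addrI (amul 0 x)); rewrite -amulDl !addr0. Qed.
Lemma amul0r x : amul x 0 = 0.
Proof. by apply: (addrI (amul x 0)); rewrite -amulDr !addr0. Qed.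
Lemma amulNl x y : amul (- x) y = - amul x y.
Proof. by rewrite -scaleN1r amulZl scaleN1r. Qed.
Lemma amulNr x y : amul x (- y) = - amul x y.
Proof. by rewrite -scaleN1r amulZr scaleN1r. Qed.
Lemma astarN x : astar (- x) = - astar x.
Proof. by rewrite -scaleN1r astarZ rmorphN1 scaleN1r. Qed.
Lemma astarB x y : astar (x - y) = astar x - astar y.
Proof. by rewrite astarD astarN. Qed.

End StarAlgTheory.

Section PreCstarTheory.
Variables (R : realType) (A : preCstarType R).
Implicit Types x y : A.

Lemma snorm0 : snorm (0 : A) = 0.
Proof. by rewrite -(scale0r (0 : A)) snormZ normc0 mul0r. Qed.
Lemma snormN x : snorm (- x) = snorm x.
Proof. by rewrite -scaleN1r snormZ normcN normc1 mul1r. Qed.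
Lemma snormB x y : snorm (x - y) <= snorm x + snorm y.
Proof. by rewrite -(snormN y) snormD. Qed.
Lemma snorm_star x : snorm (astar x) = snorm x.
Proof.
have le z : snorm z <= snorm (astar z).
  have [->|z0] := eqVneq (snorm z) 0; first exact: snorm_ge0.
  have zp : 0 < snorm z by rewrite lt_def z0 snorm_ge0.
  by rewrite -(ler_pM2r zp) -expr2 -snorm_cstar snormM.
by apply/eqP; rewrite eq_le le -{2}(astarK x) le.
Qed.
End PreCstarTheory.

(* The algebra of all families (x_i), with pointwise operations. *)
Definition prodAlg (R : realType) (I : Type) (B : I -> starAlgType R) :=
  forall i, B i.

Section ProdAlg.
Variables (R : realType) (I : Type) (B : I -> starAlgType R).
Local Notation P := (prodAlg B).
Implicit Types x y z : P.

HB.instance Definition _ := gen_eqMixin P.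
HB.instance Definition _ := gen_choiceMixin P.

Fact prod_addA : associative (fun x y : P => (fun i => x i + y i) : P).
Proof.
by move=> x y z; apply: functional_extensionality_dep => i; rewrite addrA.
Qed.
Fact prod_addC : commutative (fun x y : P => (fun i => x i + y i) : P).
Proof.
by move=> x y; apply: functional_extensionality_dep => i; rewrite addrC.
Qed.
Fact prod_add0 : left_id ((fun i => 0) : P) (fun x y : P => (fun i => x i + y i) : P).
Proof.
by move=> x; apply: functional_extensionality_dep => i; rewrite add0r.
Qed.
Fact prod_addN : left_inverse ((fun i => 0) : P) (fun x : P => (fun i => - x i) : P)
  (fun x y : P => (fun i => x i + y i) : P).
Proof.
by move=> x; apply: functional_extensionality_dep => i; rewrite addNr.
Qed.
HB.instance Definition _ :=
  GRing.isZmodule.Build P prod_addA prod_addC prod_add0 prod_addN.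

Definition prod_scale (c : R[i]) x : P := fun i => c *: x i.
Fact prod_scaleA (a b : R[i]) x : prod_scale a (prod_scale b x) = prod_scale (a * b) x.
Proof.
by apply: functional_extensionality_dep => i; rewrite /prod_scale scalerA.
Qed.
Fact prod_scale1 : left_id 1 prod_scale.
Proof.
by move=> x; apply: functional_extensionality_dep => i;
  rewrite /prod_scale scale1r.
Qed.
Fact prod_scaleDr : right_distributive prod_scale +%R.
Proof.
by move=> c x y; apply: functional_extensionality_dep => i;
  rewrite /prod_scale scalerDr.
Qed.
Fact prod_scaleDl x : {morph prod_scale^~ x : a b / a + b}.
Proof.
by move=> c d; apply: functional_extensionality_dep => i;
  rewrite /prod_scale scalerDl.
Qed.
HB.instance Definition _ := GRing.Zmodule_isLmodule.Build R[i] P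
  prod_scaleA prod_scale1 prod_scaleDr prod_scaleDl.

Definition prod_mul x y : P := fun i => amul (x i) (y i).
Definition prod_star x : P := fun i => astar (x i).
Fact prod_mulA : associative prod_mul.
Proof.
by move=> x y z; apply: functional_extensionality_dep => i; exact: amulA.
Qed.
Fact prod_mulDl : left_distributive prod_mul +%R.
Proof.
by move=> x y z; apply: functional_extensionality_dep => i; exact: amulDl.
Qed.
Fact prod_mulDr : right_distributive prod_mul +%R.
Proof.
by move=> x y z; apply: functional_extensionality_dep => i; exact: amulDr.
Qed.
Fact prod_mulZl : forall (c : R[i]) (x y : P), prod_mul (c *: x) y = c *: prod_mul x y.
Proof.
by move=> c x y; apply: functional_extensionality_dep => i; exact: amulZl.
Qed.
Fact prod_mulZr : forall (c : R[i]) (x y : P), prod_mul x (c *: y) = c *: prod_mul x y.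
Proof.
by move=> c x y; apply: functional_extensionality_dep => i; exact: amulZr.
Qed.
Fact prod_starK : involutive prod_star.
Proof.
by move=> x; apply: functional_extensionality_dep => i; exact: astarK.
Qed.
Fact prod_starD : {morph prod_star : x y / x + y}.
Proof.
by move=> x y; apply: functional_extensionality_dep => i; exact: astarD.
Qed.
Fact prod_starZ : forall (c : R[i]) (x : P), prod_star (c *: x) = c^* *: prod_star x.
Proof.
by move=> c x; apply: functional_extensionality_dep => i; exact: astarZ.
Qed.
Fact prod_starM : forall x y : P, prod_star (prod_mul x y) = prod_mul (prod_star y) (prod_star x).
Proof.
by move=> x y; apply: functional_extensionality_dep => i; exact: astarM.
Qed.
HB.instance Definition _ := Lmodule_isStarAlgebra.Build R P
  prod_mulA prod_mulDl prod_mulDr prod_mulZl prod_mulZr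
  prod_starK prod_starD prod_starZ prod_starM.

Lemma prodAlgD x y i : (x + y) i = x i + y i. Proof. by []. Qed.
Lemma prodAlgN x i : (- x) i = - x i. Proof. by []. Qed.
Lemma prodAlg0 i : (0 : P) i = 0. Proof. by []. Qed.
Lemma prodAlgZ (c : R[i]) x i : (c *: x) i = c *: x i. Proof. by []. Qed.
Lemma prodAlgM x y i : (amul x y) i = amul (x i) (y i). Proof. by []. Qed.
Lemma prodAlgS x i : (astar x) i = astar (x i). Proof. by []. Qed.
End ProdAlg.

Record starSubalg (R : realType) (A : starAlgType R) := StarSubalg {
  subalg_set : set A;
  subalg0 : subalg_set 0;
  subalgD : forall x y, subalg_set x -> subalg_set y -> subalg_set (x + y);
  subalgZ : forall (c : R[i]) x, subalg_set x -> subalg_set (c *: x);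
  subalgM : forall x y, subalg_set x -> subalg_set y -> subalg_set (amul x y);
  subalgS : forall x, subalg_set x -> subalg_set (astar x) }.

Record subAlg (R : realType) (A : starAlgType R) (S : starSubalg A) :=
  SubAlg { subval :> A; subvalP : subalg_set S subval }.

Section SubAlg.
Variables (R : realType) (A : starAlgType R) (S : starSubalg A).
Local Notation T := (subAlg S).
Implicit Types x y z : T.

HB.instance Definition _ := gen_eqMixin T.
HB.instance Definition _ := gen_choiceMixin T.

Lemma subval_inj : injective (@subval R A S).
Proof.
by move=> [x px] [y py] /= e; subst y; congr SubAlg; exact: Prop_irrelevance.
Qed.

Fact subalgN (x : A) : subalg_set S x -> subalg_set S (- x).
Proof. by move=> Sx; rewrite -scaleN1r; exact: subalgZ. Qed.

Definition sub_zero : T := SubAlg (subalg0 S).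
Definition sub_add x y : T := SubAlg (subalgD (subvalP x) (subvalP y)).
Definition sub_opp x : T := SubAlg (subalgN (subvalP x)).
Definition sub_scale (c : R[i]) x : T := SubAlg (subalgZ c (subvalP x)).
Definition sub_mul x y : T := SubAlg (subalgM (subvalP x) (subvalP y)).
Definition sub_star x : T := SubAlg (subalgS (subvalP x)).

Fact sub_addA : associative sub_add.
Proof. by move=> x y z; apply: subval_inj; rewrite /= addrA. Qed.
Fact sub_addC : commutative sub_add.
Proof. by move=> x y; apply: subval_inj; rewrite /= addrC. Qed.
Fact sub_add0 : left_id sub_zero sub_add.
Proof. by move=> x; apply: subval_inj; rewrite /= add0r. Qed.
Fact sub_addN : left_inverse sub_zero sub_opp sub_add.
Proof. by move=> x; apply: subval_inj; rewrite /= addNr. Qed.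
HB.instance Definition _ :=
  GRing.isZmodule.Build T sub_addA sub_addC sub_add0 sub_addN.

Fact sub_scaleA (a b : R[i]) x : sub_scale a (sub_scale b x) = sub_scale (a * b) x.
Proof. by apply: subval_inj; rewrite /= scalerA. Qed.
Fact sub_scale1 : left_id 1 sub_scale.
Proof. by move=> x; apply: subval_inj; rewrite /= scale1r. Qed.
Fact sub_scaleDr : right_distributive sub_scale +%R.
Proof. by move=> c x y; apply: subval_inj; rewrite /= scalerDr. Qed.
Fact sub_scaleDl x : {morph sub_scale^~ x : a b / a + b}.
Proof. by move=> c d; apply: subval_inj; rewrite /= scalerDl. Qed.
HB.instance Definition _ := GRing.Zmodule_isLmodule.Build R[i] T
  sub_scaleA sub_scale1 sub_scaleDr sub_scaleDl.

Fact sub_mulA : associative sub_mul.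
Proof. by move=> x y z; apply: subval_inj; exact: amulA. Qed.
Fact sub_mulDl : left_distributive sub_mul +%R.
Proof. by move=> x y z; apply: subval_inj; exact: amulDl. Qed.
Fact sub_mulDr : right_distributive sub_mul +%R.
Proof. by move=> x y z; apply: subval_inj; exact: amulDr. Qed.
Fact sub_mulZl : forall (c : R[i]) (x y : T), sub_mul (c *: x) y = c *: sub_mul x y.
Proof. by move=> c x y; apply: subval_inj; exact: amulZl. Qed.
Fact sub_mulZr : forall (c : R[i]) (x y : T), sub_mul x (c *: y) = c *: sub_mul x y.
Proof. by move=> c x y; apply: subval_inj; exact: amulZr. Qed.
Fact sub_starK : involutive sub_star.
Proof. by move=> x; apply: subval_inj; exact: astarK. Qed.
Fact sub_starD : {morph sub_star : x y / x + y}.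
Proof. by move=> x y; apply: subval_inj; exact: astarD. Qed.
Fact sub_starZ : forall (c : R[i]) (x : T), sub_star (c *: x) = c^* *: sub_star x.
Proof. by move=> c x; apply: subval_inj; exact: astarZ. Qed.
Fact sub_starM : forall x y : T, sub_star (sub_mul x y) = sub_mul (sub_star y) (sub_star x).
Proof. by move=> x y; apply: subval_inj; exact: astarM. Qed.
HB.instance Definition _ := Lmodule_isStarAlgebra.Build R T
  sub_mulA sub_mulDl sub_mulDr sub_mulZl sub_mulZr
  sub_starK sub_starD sub_starZ sub_starM.

End SubAlg.

Record starIdeal (R : realType) (A : starAlgType R) := StarIdeal {
  ideal_set : set A;
  ideal0 : ideal_set 0;
  idealD : forall x y, ideal_set x -> ideal_set y -> ideal_set (x + y);
  idealZ : forall (c : R[i]) x, ideal_set x -> ideal_set (c *: x);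
  idealMl : forall x y, ideal_set y -> ideal_set (amul x y);
  idealMr : forall x y, ideal_set x -> ideal_set (amul x y);
  idealS : forall x, ideal_set x -> ideal_set (astar x) }.

Section QuotAlg.
Local Open Scope quotient_scope.
Variables (R : realType) (A : starAlgType R) (I : starIdeal A).
Implicit Types x y z : A.

Definition ideal_rel : rel A := fun x y => `[< ideal_set I (x - y) >].

Fact idealN x : ideal_set I x -> ideal_set I (- x).
Proof. by move=> Ix; rewrite -scaleN1r; exact: idealZ. Qed.
Fact ideal_rel_refl : reflexive ideal_rel.
Proof. by move=> x; apply/asboolP; rewrite subrr; exact: ideal0. Qed.
Fact ideal_rel_sym : symmetric ideal_rel.
Proof. by move=> x y; apply/asboolP/asboolP => /idealN; rewrite opprB. Qed.
Fact ideal_rel_trans : transitive ideal_rel.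
Proof.
move=> y x z /asboolP xy /asboolP yz; apply/asboolP.
by rewrite -(subrKA y); exact: idealD.
Qed.
Canonical ideal_equiv :=
  EquivRel ideal_rel ideal_rel_refl ideal_rel_sym ideal_rel_trans.

Definition quotAlg := {eq_quot ideal_equiv}.
HB.instance Definition _ := Choice.on quotAlg.
HB.instance Definition _ := EqQuotient.on quotAlg.
Local Notation Q := quotAlg.

Definition quot_pi x : Q := \pi_{eq_quot ideal_equiv} x.
Definition quot_repr (x : Q) : A := repr x.
Lemma quot_reprK (x : Q) : quot_pi (quot_repr x) = x.
Proof. exact: reprK. Qed.
Lemma quot_ind (P : Q -> Prop) : (forall x, P (quot_pi x)) -> forall x : Q, P x.
Proof. by move=> Ppi x; rewrite -[x]quot_reprK. Qed.
Lemma quotAlgE x y : quot_pi x = quot_pi y <-> ideal_set I (x - y).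
Proof.
split=> [/eqP|Ixy]; first by rewrite eqmodE => /asboolP.
by apply/eqP; rewrite eqmodE; apply/asboolP.
Qed.
Lemma quotAlg_repr x : ideal_set I (quot_repr (quot_pi x) - x).
Proof. by apply/quotAlgE; rewrite quot_reprK. Qed.

Definition quot_zero : Q := quot_pi 0.
Definition quot_add (x y : Q) : Q := quot_pi (quot_repr x + quot_repr y).
Definition quot_opp (x : Q) : Q := quot_pi (- quot_repr x).
Definition quot_scale (c : R[i]) (x : Q) : Q := quot_pi (c *: quot_repr x).
Definition quot_mul (x y : Q) : Q := quot_pi (amul (quot_repr x) (quot_repr y)).
Definition quot_star (x : Q) : Q := quot_pi (astar (quot_repr x)).

Let piD x y : quot_add (quot_pi x) (quot_pi y) = quot_pi (x + y).
Proof.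
apply/quotAlgE; rewrite opprD addrACA; apply: idealD; exact: quotAlg_repr.
Qed.
Let piN x : quot_opp (quot_pi x) = quot_pi (- x).
Proof.
by apply/quotAlgE; rewrite -opprD; apply: idealN; exact: quotAlg_repr.
Qed.
Let piZ c x : quot_scale c (quot_pi x) = quot_pi (c *: x).
Proof.
by apply/quotAlgE; rewrite -scalerBr; apply: idealZ; exact: quotAlg_repr.
Qed.
Let piM x y : quot_mul (quot_pi x) (quot_pi y) = quot_pi (amul x y).
Proof.
apply/quotAlgE; set x' := quot_repr _; set y' := quot_repr _.
have -> : amul x' y' - amul x y = amul (x' - x) y' + amul x (y' - y).
  by rewrite amulDl amulDr amulNl amulNr addrA subrK.
by apply: idealD; [apply: idealMr|apply: idealMl]; exact: quotAlg_repr.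
Qed.
Let piS x : quot_star (quot_pi x) = quot_pi (astar x).
Proof.
by apply/quotAlgE; rewrite -astarB; apply: idealS; exact: quotAlg_repr.
Qed.

Fact quot_addA : associative quot_add.
Proof.
by move=> x y z; elim/quot_ind: x => x; elim/quot_ind: y => y;
  elim/quot_ind: z => z; rewrite !piD addrA.
Qed.
Fact quot_addC : commutative quot_add.
Proof.
by move=> x y; elim/quot_ind: x => x; elim/quot_ind: y => y;
  rewrite !piD addrC.
Qed.
Fact quot_add0 : left_id quot_zero quot_add.
Proof. by move=> x; elim/quot_ind: x => x; rewrite !piD add0r. Qed.
Fact quot_addN : left_inverse quot_zero quot_opp quot_add.
Proof. by move=> x; elim/quot_ind: x => x; rewrite piN piD addNr. Qed.
HB.instance Definition _ :=
  GRing.isZmodule.Build Q quot_addA quot_addC quot_add0 quot_addN.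

Let piD' x y : quot_pi x + quot_pi y = quot_pi (x + y).
Proof. exact: piD. Qed.

Fact quot_scaleA (a b : R[i]) (x : Q) : quot_scale a (quot_scale b x) = quot_scale (a * b) x.
Proof. by elim/quot_ind: x => x; rewrite !piZ scalerA. Qed.
Fact quot_scale1 : left_id 1 quot_scale.
Proof. by move=> x; elim/quot_ind: x => x; rewrite piZ scale1r. Qed.
Fact quot_scaleDr : right_distributive quot_scale +%R.
Proof.
by move=> c x y; elim/quot_ind: x => x; elim/quot_ind: y => y;
  rewrite !(piZ, piD') scalerDr.
Qed.
Fact quot_scaleDl (x : Q) : {morph quot_scale^~ x : a b / a + b}.
Proof. by elim/quot_ind: x => x a b /=; rewrite !(piZ, piD') scalerDl. Qed.
HB.instance Definition _ := GRing.Zmodule_isLmodule.Build R[i] Q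
  quot_scaleA quot_scale1 quot_scaleDr quot_scaleDl.

Let piZ' (c : R[i]) x : c *: quot_pi x = quot_pi (c *: x).
Proof. exact: piZ. Qed.

Fact quot_mulA : associative quot_mul.
Proof.
by move=> x y z; elim/quot_ind: x => x; elim/quot_ind: y => y;
  elim/quot_ind: z => z; rewrite ?(piM, piD', piZ', piS) amulA.
Qed.
Fact quot_mulDl : left_distributive quot_mul +%R.
Proof.
by move=> x y z; elim/quot_ind: x => x; elim/quot_ind: y => y;
  elim/quot_ind: z => z; rewrite ?(piM, piD', piZ', piS) amulDl.
Qed.
Fact quot_mulDr : right_distributive quot_mul +%R.
Proof.
by move=> x y z; elim/quot_ind: x => x; elim/quot_ind: y => y;
  elim/quot_ind: z => z; rewrite ?(piM, piD', piZ', piS) amulDr.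
Qed.
Fact quot_mulZl : forall (c : R[i]) (x y : Q), quot_mul (c *: x) y = c *: quot_mul x y.
Proof.
by move=> c x y; elim/quot_ind: x => x; elim/quot_ind: y => y;
  rewrite ?(piM, piD', piZ', piS) amulZl.
Qed.
Fact quot_mulZr : forall (c : R[i]) (x y : Q), quot_mul x (c *: y) = c *: quot_mul x y.
Proof.
by move=> c x y; elim/quot_ind: x => x; elim/quot_ind: y => y;
  rewrite ?(piM, piD', piZ', piS) amulZr.
Qed.
Fact quot_starK : involutive quot_star.
Proof.
by move=> x; elim/quot_ind: x => x; rewrite ?(piM, piD', piZ', piS) astarK.
Qed.
Fact quot_starD : {morph quot_star : x y / x + y}.
Proof.
by move=> x y; elim/quot_ind: x => x; elim/quot_ind: y => y;
  rewrite ?(piM, piD', piZ', piS) astarD.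
Qed.
Fact quot_starZ : forall (c : R[i]) (x : Q), quot_star (c *: x) = c^* *: quot_star x.
Proof.
by move=> c x; elim/quot_ind: x => x; rewrite ?(piM, piD', piZ', piS) astarZ.
Qed.
Fact quot_starM : forall x y : Q, quot_star (quot_mul x y) = quot_mul (quot_star y) (quot_star x).
Proof.
by move=> x y; elim/quot_ind: x => x; elim/quot_ind: y => y;
  rewrite ?(piM, piD', piZ', piS) astarM.
Qed.
HB.instance Definition _ := Lmodule_isStarAlgebra.Build R Q
  quot_mulA quot_mulDl quot_mulDr quot_mulZl quot_mulZr
  quot_starK quot_starD quot_starZ quot_starM.

Lemma quot_piD : {morph quot_pi : x y / x + y}.
Proof. by move=> x y; rewrite -?piD. Qed.
Lemma quot_piZ (c : R[i]) x : quot_pi (c *: x) = c *: quot_pi x.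
Proof. by rewrite -?piZ. Qed.
Lemma quot_piM x y : quot_pi (amul x y) = amul (quot_pi x) (quot_pi y).
Proof. by rewrite -?piM. Qed.
Lemma quot_piS x : quot_pi (astar x) = astar (quot_pi x).
Proof. by rewrite -?piS. Qed.
Lemma quot_pi0 : quot_pi 0 = 0.
Proof. by []. Qed.
End QuotAlg.

Section Sequences.
Variables (R : realType) (B : nat -> preCstarType R).
Local Notation P := (prodAlg (fun n => B n : starAlgType R)).

Definition bounded_seq : set P :=
  [set x | exists M : R, forall n, snorm (x n) <= M].

Fact bounded_seq0 : bounded_seq 0.
Proof. by exists 0 => n; rewrite snorm0. Qed.
Fact bounded_seqD x y : bounded_seq x -> bounded_seq y -> bounded_seq (x + y).
Proof.
by move=> [M xM] [N yN]; exists (M + N) => n; rewrite (le_trans (snormD _ _))// lerD.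
Qed.
Fact bounded_seqZ (c : R[i]) x : bounded_seq x -> bounded_seq (c *: x).
Proof.
move=> [M xM]; exists (normc c * M) => n.
by rewrite snormZ ler_wpM2l// /normc; case: c => a b; exact: sqrtr_ge0.
Qed.
Fact bounded_seqM x y : bounded_seq x -> bounded_seq y -> bounded_seq (amul x y).
Proof.
move=> [M xM] [N yN]; exists (M * N) => n.
by rewrite (le_trans (snormM _ _))// ler_pM// snorm_ge0.
Qed.
Fact bounded_seqS x : bounded_seq x -> bounded_seq (astar x).
Proof. by move=> [M xM]; exists M => n; rewrite snorm_star. Qed.
Definition bounded_subalg :=
  StarSubalg bounded_seq0 bounded_seqD bounded_seqZ bounded_seqM bounded_seqS.

Definition bounded_prod := subAlg bounded_subalg.
HB.instance Definition _ := StarAlgebra.on bounded_prod.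
Definition seq_at (x : bounded_prod) (n : nat) : B n := (subval x : P) n.

Definition null_seq : set bounded_prod :=
  [set x | (fun n => snorm (seq_at x n)) @ \oo --> (0 : R)].

Let null_squeeze (x : bounded_prod) (u : R^nat) :
  (forall n, snorm (seq_at x n) <= u n) -> u @ \oo --> (0 : R) -> null_seq x.
Proof.
move=> xu u0; apply: (squeeze_cvgr _ (cvg_cst 0) u0).
by apply: nearW => n; rewrite snorm_ge0 xu.
Qed.

Fact null_seq0 : null_seq 0.
Proof.
by apply: (null_squeeze (u := fun=> 0)) => [n|]; [rewrite snorm0|exact: cvg_cst].
Qed.
Fact null_seqD x y : null_seq x -> null_seq y -> null_seq (x + y).
Proof.
move=> x0 y0; apply: (null_squeeze (u := fun n => snorm (seq_at x n) + snorm (seq_at y n))).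
  by move=> n; exact: snormD.
by rewrite -(addr0 (0 : R)); exact: cvgD.
Qed.
Fact null_seqZ (c : R[i]) x : null_seq x -> null_seq (c *: x).
Proof.
move=> x0; apply: (null_squeeze (u := fun n => normc c * snorm (seq_at x n))).
  by move=> n; rewrite -snormZ.
by rewrite -(mulr0 (normc c)); apply: cvgM => //; exact: cvg_cst.
Qed.
Fact null_seqMl x y : null_seq y -> null_seq (amul x y).
Proof.
have [M xM] := subvalP x.
move=> y0; apply: (null_squeeze (u := fun n => M * snorm (seq_at y n))).
  by move=> n; rewrite (le_trans (snormM _ _))// ler_wpM2r// snorm_ge0.
by rewrite -(mulr0 M); apply: cvgM => //; exact: cvg_cst.
Qed.
Fact null_seqMr x y : null_seq x -> null_seq (amul x y).
Proof.
have [M yM] := subvalP y.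
move=> x0; apply: (null_squeeze (u := fun n => snorm (seq_at x n) * M)).
  by move=> n; rewrite (le_trans (snormM _ _))// ler_wpM2l// snorm_ge0.
by rewrite -(mul0r M); apply: cvgM => //; exact: cvg_cst.
Qed.
Fact null_seqS x : null_seq x -> null_seq (astar x).
Proof.
by move=> x0; apply: null_squeeze x0 => n;
  rewrite /seq_at /= prodAlgS snorm_star.
Qed.
Definition null_ideal := StarIdeal null_seq0 null_seqD null_seqZ
  null_seqMl null_seqMr null_seqS.

(* The C*-algebra prod_n B_n / bigoplus_n B_n, as a *-algebra. *)
Definition prod_mod_sum := quotAlg null_ideal.
HB.instance Definition _ := StarAlgebra.on prod_mod_sum.
End Sequences.

(* The (Hausdorff) completion of A, realised as the algebra of Cauchy sequences
   modulo null sequences inside prod_n A / bigoplus_n A. *)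
Section Completion.
Variables (R : realType) (A : preCstarType R).
Local Notation Q := (prod_mod_sum (fun=> A)).

Definition cauchy_seq (x : nat -> A) := forall e : R, 0 < e ->
  exists N, forall m n, (N <= m)%N -> (N <= n)%N -> snorm (x m - x n) < e.

Definition cauchy_class : set Q :=
  [set quot_pi _ x | x in [set x : bounded_prod (fun=> A) | cauchy_seq (seq_at x)]].

Fact cauchy_class0 : cauchy_class 0.
Proof.
by exists 0 => //= e e0; exists 0%N => m n _ _; rewrite subr0 snorm0.
Qed.
Fact cauchy_classD x y : cauchy_class x -> cauchy_class y -> cauchy_class (x + y).
Proof.
move=> [{}x xc <-] [{}y yc <-]; exists (x + y); last exact: quot_piD.
move=> e e0; have e2 : 0 < e / 2 by rewrite divr_gt0.
have [N xN] := xc _ e2; have [M yM] := yc _ e2.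
exists (maxn N M) => m n; rewrite !geq_max => /andP[Nm Mm] /andP[Nn Mn].
rewrite /= opprD addrACA (le_lt_trans (snormD _ _))// (splitr e) ltrD//.
  exact: xN.
exact: yM.
Qed.
Fact cauchy_classZ (c : R[i]) x : cauchy_class x -> cauchy_class (c *: x).
Proof.
move=> [{}x xc <-]; exists (c *: x); last exact: quot_piZ.
move=> e e0; have c0 : 0 <= normc c by case: c => a b; exact: sqrtr_ge0.
have [|N xN] := xc (e / (normc c + 1)); first by rewrite divr_gt0// ltr_wpDl.
exists N => m n Nm Nn; rewrite /= -scalerBr snormZ.
have := xN _ _ Nm Nn; rewrite ltr_pdivlMr ?ltr_wpDl// => /(le_lt_trans _); apply.
by rewrite mulrC ler_wpM2l ?snorm_ge0// lerDl.
Qed.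
Fact cauchy_classM x y : cauchy_class x -> cauchy_class y -> cauchy_class (amul x y).
Proof.
move=> [{}x xc <-] [{}y yc <-]; exists (amul x y); last exact: quot_piM.
move=> e e0; have [Mx xM] := subvalP x; have [My yM] := subvalP y.
pose M := Num.max (Num.max Mx My) 1.
have M0 : 0 < M by rewrite lt_max ltr01 orbT.
have [|N xN] := xc (e / 2 / M); first by rewrite !divr_gt0.
have [|N' yN] := yc (e / 2 / M); first by rewrite !divr_gt0.
exists (maxn N N') => m n; rewrite !geq_max => /andP[Nm Mm] /andP[Nn Mn].
set a := seq_at x in xM xN *; set b := seq_at y in yM yN *.
rewrite (_ : _ - _
  = amul (a m - a n) (b m) + amul (a n) (b m - b n)); last first.
  by rewrite amulDl amulDr amulNl amulNr addrA subrK.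
rewrite (le_lt_trans (snormD _ _))// (splitr e) ltrD//.
  apply: le_lt_trans (snormM _ _) _.
  have := xN _ _ Nm Nn; rewrite ltr_pdivlMr// => /(le_lt_trans _); apply.
  by rewrite ler_wpM2l ?snorm_ge0// (le_trans (yM m))// !le_max lexx orbT.
apply: le_lt_trans (snormM _ _) _.
have := yN _ _ Mm Mn; rewrite ltr_pdivlMr// mulrC => /(le_lt_trans _); apply.
by rewrite ler_wpM2r ?snorm_ge0// (le_trans (xM n))// !le_max lexx.
Qed.
Fact cauchy_classS x : cauchy_class x -> cauchy_class (astar x).
Proof.
move=> [{}x xc <-]; exists (astar x); last exact: quot_piS.
move=> e /xc[N xN]; exists N => m n Nm Nn.
by rewrite /= prodAlgS -astarB snorm_star xN.
Qed.
Definition cauchy_subalg := StarSubalg cauchy_class0 cauchy_classD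
  cauchy_classZ cauchy_classM cauchy_classS.

Definition completion := subAlg cauchy_subalg.
HB.instance Definition _ := StarAlgebra.on completion.
End Completion.

Section DotNorm.
Variables (R : realType) (U : lmodType R[i]) (ip : {dot U for conjC}).
Implicit Types u v : U.

(* The norm u |-> sqrt <u, u>, with values in R. *)
Definition dnorm u : R := Num.sqrt (complex.Re (ip u u)).

Lemma normc_ge0 (c : R[i]) : 0 <= normc c.
Proof. by case: c => a b; exact: sqrtr_ge0. Qed.

Lemma dnormr_ge0 u : 0 <= dnorm u.
Proof. exact: sqrtr_ge0. Qed.

Lemma dnormE u : ip u u = ((dnorm u) ^+ 2)%:C%C.
Proof.
have := dnorm_ge0 ip u; case E : (ip u u) => [a b].
rewrite lecE /= => /andP[/eqP b0 a0].
by rewrite /dnorm E /= sqr_sqrtr// b0.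
Qed.

Lemma dnorm2 u : dnorm u ^+ 2 = complex.Re (ip u u).
Proof. by rewrite dnormE. Qed.

Lemma dnorm0 : dnorm 0 = 0.
Proof. by rewrite /dnorm linear0r /= sqrtr0. Qed.

Lemma dnorm0_eq0 u : dnorm u = 0 -> u = 0.
Proof. by move=> u0; apply/eqP; rewrite -(dnorm_eq0 ip) dnormE u0 expr0n. Qed.

Lemma dnormrZ (c : R[i]) u : dnorm (c *: u) = normc c * dnorm u.
Proof.
apply/eqP; rewrite -(@eqrXn2 _ 2)// ?dnormr_ge0 ?mulr_ge0 ?normc_ge0 ?dnormr_ge0//.
apply/eqP/(@complexI R); rewrite -dnormE dnormZ dnormE exprMn.
by rewrite -[ `|c| ]/((normc c)%:C%C) -rmorphXn -rmorphM.
Qed.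

Lemma dnormD2 u v :
  dnorm (u + v) ^+ 2 = dnorm u ^+ 2 + dnorm v ^+ 2 + complex.Re (ip u v) *+ 2.
Proof.
rewrite !dnorm2 (dnormD ip u v).
by case: (ip u u) => a b; case: (ip v v) => c d; case: (ip u v) => e f /=.
Qed.

Lemma Re_ip_le u v : complex.Re (ip u v) <= dnorm u * dnorm v.
Proof.
have [u0|u0] := eqVneq (dnorm u) 0.
  by rewrite (dnorm0_eq0 u0) linear0l /= dnorm0 mul0r.
have [v0|v0] := eqVneq (dnorm v) 0.
  by rewrite (dnorm0_eq0 v0) linear0r /= dnorm0 mulr0.
have up : 0 < dnorm u by rewrite lt_def u0 dnormr_ge0.
have vp : 0 < dnorm v by rewrite lt_def v0 dnormr_ge0.
have := sqr_ge0 (dnorm ((dnorm v)%:C%C *: u + (- dnorm u)%:C%C *: v)).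
rewrite dnormD2 !dnormrZ linearZl_LR linearZr_LR.
have nC (a : R) : normc a%:C%C = `|a|.
  by rewrite /normc /= expr0n /= addr0 sqrtr_sqr.
rewrite !nC normrN !ger0_norm ?dnormr_ge0//.
set z := (X in complex.Re X).
rewrite (_ : complex.Re z = - (dnorm u * dnorm v * complex.Re (ip u v))); last first.
  rewrite {}/z /=; case: (ip u v) => a b.
  rewrite -[(- dnorm u)%:C%C^*]/(Complex (- dnorm u) (- 0)) /=.
  by rewrite !(mul0r, oppr0, subr0) mulNr mulrN mulrCA mulrA.
rewrite (mulrC (dnorm v)) -mulr2n mulNrn -mulrnBl pmulrn_lge0// subr_ge0.
by rewrite expr2 ler_pM2l// mulr_gt0.
Qed.

Lemma ler_dnormD u v : dnorm (u + v) <= dnorm u + dnorm v.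
Proof.
rewrite -(@ler_pXn2r _ 2)// ?nnegrE ?addr_ge0 ?dnormr_ge0//.
rewrite dnormD2 sqrrD [leRHS]addrAC lerD2l lerMn2r /=.
exact: Re_ip_le.
Qed.
End DotNorm.

Section RepNorm.
Variables (R : realType) (A : starAlgType R) (I : Type).
Variables (H : I -> lmodType R[i]) (ip : forall i, {dot H i for conjC}).
Variable rho : forall i, A -> H i -> H i.

(* The seminorm sup_i ||rho_i(a)|| (operator norms) attached to a family of
   *-representations rho_i of A on inner product spaces H_i. *)
Definition repnorm (a : A) : R :=
  sup [set r | exists i v, dnorm (ip i) v <= 1 /\ r = dnorm (ip i) (rho a v)].

Hypothesis I_inh : inhabited I.
Hypothesis rhoD : forall i a b (v : H i), rho (a + b) v = rho a v + rho b v.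
Hypothesis rhoZ : forall i (c : R[i]) a (v : H i), rho (c *: a) v = c *: rho a v.
Hypothesis rhoM : forall i a b (v : H i), rho (amul a b) v = rho a (rho b v).
Hypothesis rhoS : forall i a (u v : H i), ip i (rho a u) v = ip i u (rho (astar a) v).
Hypothesis rhoZr : forall i (c : R[i]) a (v : H i), rho a (c *: v) = c *: rho a v.
Hypothesis rho_bounded : forall a, exists M, forall i (v : H i),
  dnorm (ip i) v <= 1 -> dnorm (ip i) (rho a v) <= M.

Lemma repnorm_le a M :
  (forall i (v : H i), dnorm (ip i) v <= 1 -> dnorm (ip i) (rho a v) <= M) ->
  repnorm a <= M.
Proof.
move=> aM; apply: ge_sup; last by move=> _ [i [v [v1 ->]]]; exact: aM.
by case: I_inh => i; exists (dnorm (ip i) (rho a 0)), i, 0; rewrite dnorm0 ler01.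
Qed.

Lemma le_repnorm1 a i (v : H i) :
  dnorm (ip i) v <= 1 -> dnorm (ip i) (rho a v) <= repnorm a.
Proof.
move=> v1; apply: ub_le_sup; last by exists i, v.
by have [M aM] := rho_bounded a; exists M => _ [j [w [w1 ->]]]; exact: aM.
Qed.

Lemma repnorm_ge0 a : 0 <= repnorm a.
Proof.
case: I_inh => i; have := @le_repnorm1 a i 0; rewrite dnorm0 ler01 => /(_ isT).
by apply: le_trans; exact: dnormr_ge0.
Qed.

Lemma le_repnorm a i (v : H i) :
  dnorm (ip i) (rho a v) <= repnorm a * dnorm (ip i) v.
Proof.
have [v0|v0] := eqVneq (dnorm (ip i) v) 0.
  have a0 : rho a (0 : H i) = 0.
    by rewrite -[X in rho a X](scale0r (0 : H i)) rhoZr scale0r.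
  by rewrite (dnorm0_eq0 v0) a0 dnorm0 mulr0.
have vp : 0 < dnorm (ip i) v by rewrite lt_def v0 dnormr_ge0.
pose w := ((dnorm (ip i) v)^-1)%:C%C *: v.
have nC : normc ((dnorm (ip i) v)^-1)%:C%C = (dnorm (ip i) v)^-1.
  by rewrite /normc /= expr0n /= addr0 sqrtr_sqr ger0_norm// invr_ge0 ltW.
have : dnorm (ip i) (rho a w) <= repnorm a.
  by apply: le_repnorm1; rewrite dnormrZ nC mulVf.
by rewrite rhoZr dnormrZ nC mulrC ler_pdivrMr.
Qed.

Lemma repnormD a b : repnorm (a + b) <= repnorm a + repnorm b.
Proof.
apply: repnorm_le => i v v1; rewrite rhoD (le_trans (ler_dnormD _ _ _))//.
by rewrite lerD// le_repnorm1.
Qed.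

Lemma repnormZ (c : R[i]) a : repnorm (c *: a) = normc c * repnorm a.
Proof.
have le (d : R[i]) b : repnorm (d *: b) <= normc d * repnorm b.
  apply: repnorm_le => i v v1; rewrite rhoZ dnormrZ ler_wpM2l ?normc_ge0//.
  exact: le_repnorm1.
apply/eqP; rewrite eq_le le /=.
have [->|c0] := eqVneq c 0; first by rewrite normc0 mul0r repnorm_ge0.
have cp : 0 < normc c.
  by rewrite lt_def normc_ge0 andbT; apply: contra_neq c0; exact: eq0_normc.
by rewrite -ler_pdivlMl// -normcV -{1}(scalerK c0 a) le.
Qed.

Lemma repnormM a b : repnorm (amul a b) <= repnorm a * repnorm b.
Proof.
apply: repnorm_le => i v v1; rewrite rhoM (le_trans (le_repnorm _ _))//.
by rewrite ler_wpM2l ?repnorm_ge0 ?le_repnorm1.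
Qed.

Lemma repnorm_cstar a : repnorm (amul (astar a) a) = repnorm a ^+ 2.
Proof.
have sq b : repnorm b ^+ 2 <= repnorm (amul (astar b) b).
  rewrite -[leRHS]sqr_sqrtr ?repnorm_ge0// ler_pXn2r ?nnegrE ?sqrtr_ge0 ?repnorm_ge0//.
  apply: repnorm_le => i v v1.
  rewrite -(@ler_pXn2r _ 2) ?nnegrE ?sqrtr_ge0 ?dnormr_ge0// [leRHS]sqr_sqrtr ?repnorm_ge0//.
  rewrite dnorm2 rhoS -rhoM.
  rewrite (le_trans (Re_ip_le _ _ _))// -[leRHS]mul1r.
  by rewrite ler_pM ?dnormr_ge0 ?le_repnorm1.
have star b : repnorm b <= repnorm (astar b).
  have [->|b0] := eqVneq (repnorm b) 0; first exact: repnorm_ge0.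
  have bp : 0 < repnorm b by rewrite lt_def b0 repnorm_ge0.
  by rewrite -(ler_pM2r bp) -expr2 (le_trans (sq b))// repnormM.
apply/eqP; rewrite eq_le sq andbT (le_trans (repnormM _ _))// expr2.
by rewrite ler_wpM2r ?repnorm_ge0// -{2}(astarK a) star.
Qed.
End RepNorm.

Record hilbertType (R : realType) := Hilbert {
  hilbert_sort :> lmodType R[i];
  hilbert_ip : {dot hilbert_sort for conjC};
  hilbert_complete : forall u : nat -> hilbert_sort,
    (forall e : R, 0 < e -> exists N, forall m n, (N <= m)%N -> (N <= n)%N ->
      dnorm hilbert_ip (u m - u n) < e) ->
    exists l, (fun n => dnorm hilbert_ip (u n - l)) @ \oo --> (0 : R) }.

Record unitaryRep (R : realType) (G : groupType) := UnitaryRep {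
  rep_space :> hilbertType R;
  rep_act : G -> rep_space -> rep_space;
  rep_linear : forall g, linear (rep_act g);
  rep1 : forall v, rep_act 1%g v = v;
  repM : forall g h v, rep_act (g * h)%g v = rep_act g (rep_act h v);
  rep_unitary : forall g u v,
    hilbert_ip rep_space (rep_act g u) (rep_act g v) = hilbert_ip rep_space u v }.

(* The group algebra C[G]: finitely supported functions, with convolution and
   f^*(g) = conj (f(g^-1)). *)
Record groupAlg (R : realType) (G : groupType) := GroupAlg {
  coef :> G -> R[i];
  coef_fin : finite_set [set g | coef g != 0] }.

Section GroupAlg.
Variables (R : realType) (G : groupType).
Local Notation T := (groupAlg R G).
Local Notation C := (R[i]).
Implicit Types f h : T.

HB.instance Definition _ := gen_eqMixin T.
HB.instance Definition _ := gen_choiceMixin T.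

Lemma groupAlgP f h : f =1 h -> f = h.
Proof.
case: f h => [f fP] [h hP] /= /funext e; subst h.
by congr GroupAlg; exact: Prop_irrelevance.
Qed.

Fact ga_zero_fin : finite_set [set g : G | (0 : C) != 0].
Proof. by apply: sub_finite_set (finite_set0 G) => g /=; rewrite eqxx. Qed.
Definition ga_zero : T := GroupAlg ga_zero_fin.

Fact ga_add_fin f h : finite_set [set g | f g + h g != 0].
Proof.
apply: (@sub_finite_set _ _ ([set g | f g != 0] `|` [set g | h g != 0])).
  move=> g /=; have [->|] := eqVneq (f g) 0; last by left.
  by rewrite add0r; right.
by rewrite finite_setU; split; exact: coef_fin.
Qed.
Definition ga_add f h : T := GroupAlg (ga_add_fin f h).

Fact ga_opp_fin f : finite_set [set g | - f g != 0].
Proof. by apply: sub_finite_set (coef_fin f) => g /=; rewrite oppr_eq0. Qed.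
Definition ga_opp f : T := GroupAlg (ga_opp_fin f).

Fact ga_scale_fin (c : C) f : finite_set [set g | c * f g != 0].
Proof.
by apply: sub_finite_set (coef_fin f) => g /=; rewrite mulf_eq0 negb_or => /andP[].
Qed.
Definition ga_scale c f : T := GroupAlg (ga_scale_fin c f).

Fact ga_addA : associative ga_add.
Proof. by move=> f g h; apply: groupAlgP => x /=; rewrite addrA. Qed.
Fact ga_addC : commutative ga_add.
Proof. by move=> f g; apply: groupAlgP => x /=; rewrite addrC. Qed.
Fact ga_add0 : left_id ga_zero ga_add.
Proof. by move=> f; apply: groupAlgP => x /=; rewrite add0r. Qed.
Fact ga_addN : left_inverse ga_zero ga_opp ga_add.
Proof. by move=> f; apply: groupAlgP => x /=; rewrite addNr. Qed.
HB.instance Definition _ :=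
  GRing.isZmodule.Build T ga_addA ga_addC ga_add0 ga_addN.

Fact ga_scaleA (a b : C) f : ga_scale a (ga_scale b f) = ga_scale (a * b) f.
Proof. by apply: groupAlgP => x /=; rewrite mulrA. Qed.
Fact ga_scale1 : left_id 1 ga_scale.
Proof. by move=> f; apply: groupAlgP => x /=; rewrite mul1r. Qed.
Fact ga_scaleDr : right_distributive ga_scale +%R.
Proof. by move=> c f h; apply: groupAlgP => x /=; rewrite mulrDr. Qed.
Fact ga_scaleDl f : {morph ga_scale^~ f : a b / a + b}.
Proof. by move=> a b; apply: groupAlgP => x /=; rewrite mulrDl. Qed.
HB.instance Definition _ := GRing.Zmodule_isLmodule.Build C T
  ga_scaleA ga_scale1 ga_scaleDr ga_scaleDl.

Definition supp f : {fset G} := fset_set [set g | f g != 0].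
Lemma suppPn f g : g \notin supp f -> f g = 0.
Proof.
by rewrite /supp in_fset_set ?notin_setE /=; [move/negP/negPn/eqP|exact: coef_fin].
Qed.

Lemma fsum_supp (V : lmodType C) (F : G -> V) f (A : {fset G}) :
  {subset supp f <= A} ->
  \sum_(g \in [set: G]) f g *: F g = \sum_(g <- A) f g *: F g.
Proof.
move=> sA; apply: fsbigTE => g gA.
by rewrite (@suppPn f g) ?scale0r//; apply: contra gA; exact: sA.
Qed.

Definition ga_eval (V : lmodType C) (act : G -> V -> V) f (v : V) : V :=
  \sum_(g \in [set: G]) f g *: act g v.

Section Eval.
Variables (V : lmodType C) (act : G -> V -> V).

Lemma ga_evalE f v : ga_eval act f v = \sum_(g <- supp f) f g *: act g v.
Proof. exact: fsum_supp. Qed.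

Lemma ga_evalD f h v : ga_eval act (f + h) v = ga_eval act f v + ga_eval act h v.
Proof.
pose A := (supp (f + h)%R `|` (supp f `|` supp h))%fset.
rewrite /ga_eval !(@fsum_supp _ _ _ A) -?big_split /=.
- by apply: eq_bigr => g _; rewrite scalerDl.
- by move=> g gh; rewrite !inE gh !orbT.
- by move=> g gf; rewrite !inE gf !orbT.
- by move=> g gfh; rewrite !inE gfh.
Qed.

Lemma ga_evalZ (c : C) f v : ga_eval act (c *: f) v = c *: ga_eval act f v.
Proof.
pose A := (supp (c *: f)%R `|` supp f)%fset.
rewrite /ga_eval !(@fsum_supp _ _ _ A) ?scaler_sumr /=.
- by apply: eq_bigr => g _; rewrite scalerA.
- by move=> g gf; rewrite !inE gf !orbT.
- by move=> g gfh; rewrite !inE gfh.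
Qed.

Hypothesis act_lin : forall g, linear (act g).

Let actD g : {morph act g : u v / u + v}.
Proof. by move=> u v; rewrite -{1}(scale1r u) act_lin scale1r. Qed.
Let act0 g : act g 0 = 0.
Proof. by apply: (addrI (act g 0)); rewrite -actD !addr0. Qed.
Let actZ g (c : C) v : act g (c *: v) = c *: act g v.
Proof. by rewrite -[c *: v]addr0 act_lin act0 !addr0. Qed.

Lemma ga_eval_actD f : {morph ga_eval act f : u v / u + v}.
Proof.
move=> u v; rewrite !ga_evalE -big_split /=; apply: eq_bigr => g _.
by rewrite actD scalerDr.
Qed.
Lemma ga_eval_actZ f (c : C) v : ga_eval act f (c *: v) = c *: ga_eval act f v.
Proof.
rewrite !ga_evalE scaler_sumr; apply: eq_bigr => g _.
by rewrite actZ !scalerA mulrC.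
Qed.
End Eval.

Fact ga_mul_fin f h :
  finite_set [set x | \sum_(y \in [set: G]) f y * h (y^-1 * x)%g != 0].
Proof.
apply: (@sub_finite_set _ _ [set` [fset (y * z)%g | y in supp f, z in supp h]%fset]).
  2: exact: finite_fset.
move=> x /= sum0; apply/imfset2P.
have [[y yf hy]|no] := pselect (exists2 y, y \in supp f & (y^-1 * x)%g \in supp h).
  by exists y => //; exists (y^-1 * x)%g => //; rewrite mulVKg.
case/eqP: sum0; apply: fsbig1 => y _.
have [yf|/suppPn->] := boolP (y \in supp f); last by rewrite mul0r.
by rewrite (@suppPn h) ?mulr0//; apply/negP => hy; apply: no; exists y.
Qed.
Definition ga_mul f h : T := GroupAlg (ga_mul_fin f h).

Fact ga_star_fin f : finite_set [set x | (f x^-1%g)^* != 0].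
Proof.
apply: (@sub_finite_set _ _ ([set x^-1%g | x in [set x | f x != 0]])).
  by move=> x /=; rewrite conjC_eq0 => fx; exists x^-1%g => //; rewrite invgK.
exact: finite_image (coef_fin f).
Qed.
Definition ga_star f : T := GroupAlg (ga_star_fin f).

Lemma ga_evalM (V : lmodType C) (act : G -> V -> V) :
  (forall g, linear (act g)) -> (forall g k v, act (g * k)%g v = act g (act k v)) ->
  forall f h v, ga_eval act (ga_mul f h) v = ga_eval act f (ga_eval act h v).
Proof.
move=> act_lin actM f h v.
have shift y : \sum_(x \in [set: G]) h (y^-1 * x)%g *: act x v
    = act y (ga_eval act h v).
  rewrite (@reindex_fsbigT _ _ _ _ _ (fun z => (y * z)%g)); last first.
    by exists (fun z => (y^-1 * z)%g) => z; rewrite ?mulKg ?mulVKg.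
  under eq_fsbigr do rewrite mulKg actM.
  rewrite ga_evalE (@fsum_supp _ (fun z => act y (act z v)) h (supp h))//.
  have act0 : act y 0 = 0.
    have := act_lin y 1 0 0; rewrite !scale1r addr0 => e.
    by apply: (addrI (act y 0)); rewrite -e addr0.
  elim: (enum_fset (supp h)) => [|z s IH]; first by rewrite !big_nil act0.
  by rewrite !big_cons IH act_lin.
pose K := (supp (ga_mul f h) `|` [fset (y * z)%g | y in supp f, z in supp h])%fset.
rewrite [LHS](@fsum_supp _ _ _ K); last by move=> g; rewrite inE => ->.
rewrite ga_evalE.
transitivity (\sum_(x <- K) \sum_(y <- supp f) f y *: (h (y^-1 * x)%g *: act x v)).
  apply: eq_bigr => x _ /=; rewrite (@fsum_supp C^o _ f (supp f))// scaler_suml.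
  by apply: eq_bigr => y _; rewrite scalerA.
rewrite exchange_big /= big_seq [RHS]big_seq; apply: eq_bigr => y yf.
rewrite -scaler_sumr -shift; congr (_ *: _).
apply/esym/fsbigTE => x xK; rewrite (@suppPn h) ?scale0r//.
apply: contra xK => hx; rewrite inE; apply/orP; right.
by apply/imfset2P; exists y => //; exists (y^-1 * x)%g => //; rewrite mulVKg.
Qed.

Let lreg (y : G) (phi : G -> C^o) : G -> C^o := fun x => phi (y^-1 * x)%g.
Let lreg_lin y : linear (lreg y).
Proof. by move=> c u v; apply/funext. Qed.
Let lregM y z v : lreg (y * z)%g v = lreg y (lreg z v).
Proof. by apply/funext => x; rewrite /lreg invgM mulgA. Qed.
Let ga_mulE f h : ga_mul f h =1 ga_eval lreg f h.
Proof.
move=> x; rewrite ga_evalE /= (@fsum_supp C^o _ f (supp f))//.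
by rewrite fct_sumE.
Qed.
Let ga_mulE' f h : (ga_mul f h : G -> C^o) = ga_eval lreg f h.
Proof. by apply/funext; exact: ga_mulE. Qed.

Fact ga_mulA : associative ga_mul.
Proof.
move=> f g h; apply: groupAlgP => x; rewrite !ga_mulE ga_mulE'.
by rewrite (ga_evalM lreg_lin lregM).
Qed.
Fact ga_mulDl : left_distributive ga_mul +%R.
Proof.
move=> f g h; apply: groupAlgP => x.
rewrite -[RHS]/(ga_mul f h x + ga_mul g h x) !ga_mulE.
by rewrite (ga_evalD lreg).
Qed.
Fact ga_mulDr : right_distributive ga_mul +%R.
Proof.
move=> f g h; apply: groupAlgP => x.
rewrite -[RHS]/(ga_mul f g x + ga_mul f h x) !ga_mulE.
by rewrite [X in ga_eval _ _ X](_ : _ = (g : G -> C^o) + h)// (ga_eval_actD lreg_lin).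
Qed.
Fact ga_mulZl (c : C) f h : ga_mul (c *: f) h = c *: ga_mul f h.
Proof.
by apply: groupAlgP => x; rewrite -[RHS]/(c * ga_mul f h x) !ga_mulE (ga_evalZ lreg).
Qed.
Fact ga_mulZr (c : C) f h : ga_mul f (c *: h) = c *: ga_mul f h.
Proof.
apply: groupAlgP => x; rewrite -[RHS]/(c * ga_mul f h x) !ga_mulE.
by rewrite [X in ga_eval _ _ X](_ : _ = c *: (h : G -> C^o))// (ga_eval_actZ lreg_lin).
Qed.
Fact ga_starK : involutive ga_star.
Proof. by move=> f; apply: groupAlgP => x /=; rewrite invgK conjCK. Qed.
Fact ga_starD : {morph ga_star : f h / f + h}.
Proof. by move=> f h; apply: groupAlgP => x; exact: rmorphD. Qed.
Fact ga_starZ (c : C) f : ga_star (c *: f) = c^* *: ga_star f.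
Proof. by apply: groupAlgP => x; exact: rmorphM. Qed.
Fact ga_starM f h : ga_star (ga_mul f h) = ga_mul (ga_star h) (ga_star f).
Proof.
apply: groupAlgP => x /=.
rewrite [RHS](@reindex_fsbigT _ _ _ _ _ (fun z => (x * z)%g)); last first.
  by exists (fun z => (x^-1 * z)%g) => z; rewrite ?mulKg ?mulVKg.
rewrite [RHS](_ : _ = \sum_(y \in [set: G]) (f y)^* * (h (y^-1 * x^-1)%g)^*).
  rewrite (@fsum_supp C^o _ f (supp f))// rmorph_sum.
  under eq_bigr do rewrite rmorphM.
  apply/esym/fsbigTE => y /suppPn ->; by rewrite rmorph0 mul0r.
by apply: eq_fsbigr => y _; rewrite !invgM !invgK mulKg mulrC.
Qed.
HB.instance Definition _ := Lmodule_isStarAlgebra.Build R T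
  ga_mulA ga_mulDl ga_mulDr ga_mulZl ga_mulZr
  ga_starK ga_starD ga_starZ ga_starM.
End GroupAlg.

Lemma Rcauchy_cvg (R : realType) (u : R^nat) :
  (forall e : R, 0 < e -> exists N, forall m n, (N <= m)%N -> (N <= n)%N ->
    `|u m - u n| < e) -> cvgn u.
Proof.
move=> uc; apply: cauchy_cvg; apply: cauchy_exP => e e0.
have [N uN] := uc _ e0; exists (u N); exists N => // n /= Nn.
exact: uN.
Qed.

Section ComplexLimits.
Variable R : realType.
Implicit Types (u v : nat -> R[i]) (l k : R[i]).

Definition ccvg u l := (fun n => complex.Re (u n)) @ \oo --> complex.Re l /\
  (fun n => complex.Im (u n)) @ \oo --> complex.Im l.
Definition clim u : R[i] :=
  Complex (lim ((fun n => complex.Re (u n)) @ \oo))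
          (lim ((fun n => complex.Im (u n)) @ \oo)).

Lemma normc_geRe (z : R[i]) : `|complex.Re z| <= normc z.
Proof.
case: z => a b; rewrite /normc /= -sqrtr_sqr ler_sqrt ?lerDl ?sqr_ge0//.
by rewrite addr_ge0 ?sqr_ge0.
Qed.
Lemma normc_geIm (z : R[i]) : `|complex.Im z| <= normc z.
Proof.
case: z => a b; rewrite /normc /= -sqrtr_sqr ler_sqrt ?lerDr ?sqr_ge0//.
by rewrite addr_ge0 ?sqr_ge0.
Qed.
Lemma normc_le (z : R[i]) : normc z <= `|complex.Re z| + `|complex.Im z|.
Proof.
case: z => a b /=; rewrite -[leRHS]ger0_norm ?addr_ge0// -[leRHS]sqrtr_sqr.
rewrite ler_sqrt ?sqr_ge0// sqrrD !real_normK ?num_real//.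
by rewrite [leRHS]addrAC lerDl mulrn_wge0// mulr_ge0.
Qed.

Lemma ccvg_lim u l : ccvg u l -> clim u = l.
Proof.
by case: l => a b [/= ul1 ul2]; rewrite /clim (cvg_lim _ ul1)// (cvg_lim _ ul2).
Qed.

Lemma ccauchy_cvg u :
  (forall e : R, 0 < e -> exists N, forall m n, (N <= m)%N -> (N <= n)%N ->
    normc (u m - u n) < e) -> ccvg u (clim u).
Proof.
move=> uc; split; apply: Rcauchy_cvg => e /uc[N uN]; exists N => m n Nm Nn.
  apply: le_lt_trans (uN _ _ Nm Nn); rewrite (le_trans _ (normc_geRe _))//.
  by case: (u m) (u n) => [a b] [c d].
apply: le_lt_trans (uN _ _ Nm Nn); rewrite (le_trans _ (normc_geIm _))//.
by case: (u m) (u n) => [a b] [c d].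
Qed.

Lemma ccvgP u l : ccvg u l <-> (fun n => normc (u n - l)) @ \oo --> (0 : R).
Proof.
split=> [[u1 u2]|ul].
- apply: (@squeeze_cvgr _ _ _ _ (fun=> 0)
    (fun n => `|complex.Re (u n) - complex.Re l| + `|complex.Im (u n) - complex.Im l|)).
  + apply: nearW => n; rewrite normc_ge0 (le_trans (normc_le _))//.
    by case: (u n) l {u1 u2} => [a b] [c d].
  + exact: cvg_cst.
  + rewrite -(addr0 (0 : R)); apply: cvgD.
      rewrite -(normr0 R); apply: cvg_norm.
      by rewrite -(subrr (complex.Re l)); apply: cvgB => //; exact: cvg_cst.
    rewrite -(normr0 R); apply: cvg_norm.
    by rewrite -(subrr (complex.Im l)); apply: cvgB => //; exact: cvg_cst.
- split.
    apply/cvgrPdistC_lt => e e0; have /cvgrPdist_lt/(_ _ e0) := ul.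
    apply: filterS => n; rewrite sub0r normrN ger0_norm ?normc_ge0//.
    apply: le_lt_trans; rewrite (le_trans _ (normc_geRe _))//.
    by case: (u n) l {ul} => [a b] [c d].
  apply/cvgrPdistC_lt => e e0; have /cvgrPdist_lt/(_ _ e0) := ul.
  apply: filterS => n; rewrite sub0r normrN ger0_norm ?normc_ge0//.
  apply: le_lt_trans; rewrite (le_trans _ (normc_geIm _))//.
  by case: (u n) l {ul} => [a b] [c d].
Qed.

Lemma ccvgD u v l k : ccvg u l -> ccvg v k -> ccvg (fun n => u n + v n) (l + k).
Proof.
have ReD (x y : R[i]) : complex.Re (x + y) = complex.Re x + complex.Re y.
  by case: x y => [a b] [c d].
have ImD (x y : R[i]) : complex.Im (x + y) = complex.Im x + complex.Im y.
  by case: x y => [a b] [c d].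
move=> [u1 u2] [v1 v2]; split.
  by rewrite ReD; under eq_fun do rewrite ReD; exact: cvgD.
by rewrite ImD; under eq_fun do rewrite ImD; exact: cvgD.
Qed.

Lemma ccvgM u v l k : ccvg u l -> ccvg v k -> ccvg (fun n => u n * v n) (l * k).
Proof.
have ReM (x y : R[i]) : complex.Re (x * y) =
  complex.Re x * complex.Re y - complex.Im x * complex.Im y.
  by case: x y => [a b] [c d].
have ImM (x y : R[i]) : complex.Im (x * y) =
  complex.Re x * complex.Im y + complex.Im x * complex.Re y.
  by case: x y => [a b] [c d].
move=> [u1 u2] [v1 v2]; split.
  rewrite ReM; under eq_fun do rewrite ReM.
  by apply: cvgB; apply: cvgM.
rewrite ImM; under eq_fun do rewrite ImM.
by apply: cvgD; apply: cvgM.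
Qed.

Lemma ccvg_cst l : ccvg (fun=> l) l.
Proof. by split; exact: cvg_cst. Qed.

Lemma ccvg_conj u l : ccvg u l -> ccvg (fun n => (u n)^*) l^*.
Proof.
have ReC (x : R[i]) : complex.Re x^* = complex.Re x by case: x.
have ImC (x : R[i]) : complex.Im x^* = - complex.Im x by case: x.
move=> [u1 u2]; split.
  by rewrite ReC; under eq_fun do rewrite ReC.
by rewrite ImC; under eq_fun do rewrite ImC; exact: cvgN.
Qed.
End ComplexLimits.

Section ComplexHilbert.
Variable R : realType.
Local Notation C := (R[i]).

Definition cip (u v : C^o) : C := u * v^*.
Fact cip_addl v : zmod_morphism (cip^~ v).
Proof. by move=> x y; rewrite /cip mulrBl. Qed.
Fact cip_addr u : zmod_morphism (cip u).
Proof. by move=> x y; rewrite /cip rmorphB mulrBr. Qed.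
Fact cip_scalel v : scalable_for *%R (cip^~ v).
Proof. by move=> c x; rewrite /cip mulrA. Qed.
Fact cip_scaler u : scalable_for (conjC \; *%R) (cip u).
Proof. by move=> c x; rewrite /cip /= rmorphM mulrCA. Qed.
HB.instance Definition _ := isBilinear.Build C C^o C^o C *%R (conjC \; *%R) cip
  cip_addl cip_addr cip_scalel cip_scaler.
Fact cip_herm (x y : C^o) : cip x y = (-1) ^+ false * conjC (cip y x).
Proof. by rewrite expr0 mul1r /cip rmorphM /= conjCK mulrC. Qed.
HB.instance Definition _ := isHermitianSesquilinear.Build C C^o false conjC cip cip_herm.
Fact cip_gt0 (u : C^o) : u != 0 -> 0 < cip u u.
Proof. by rewrite /cip mul_conjC_gt0. Qed.
HB.instance Definition _ := isDotProduct.Build C C^o cip cip_gt0.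

Definition cdot : {dot C^o for conjC} := cip.

Lemma cdot_norm u : dnorm cdot u = normc u.
Proof.
case: u => a b; rewrite /dnorm /normc /=; congr Num.sqrt.
by rewrite mulrN opprK -!expr2.
Qed.

Fact chilbert_complete (u : nat -> C^o) :
    (forall e : R, 0 < e -> exists N, forall m n, (N <= m)%N -> (N <= n)%N ->
      dnorm cdot (u m - u n) < e) ->
    exists l, (fun n => dnorm cdot (u n - l)) @ \oo --> (0 : R).
Proof.
move=> uc; exists (clim u); under eq_fun do rewrite cdot_norm.
apply/ccvgP/ccauchy_cvg => e /uc[N uN]; exists N => m n Nm Nn.
by rewrite -cdot_norm uN.
Qed.
Definition chilbert : hilbertType R := Hilbert chilbert_complete.

Definition trivialRep (G : groupType) : unitaryRep R G :=
  @UnitaryRep R G chilbert (fun _ v => v) (fun _ _ _ _ => erefl) (fun _ => erefl)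
    (fun _ _ _ => erefl) (fun _ _ _ => erefl).
End ComplexHilbert.

Section UniversalNorm.
Variables (R : realType) (G : groupType).
Local Notation T := (groupAlg R G).
Local Notation C := (R[i]).
Implicit Types f h : T.

(* The extension of the unitary representation pi to C[G]. *)
Definition rep_eval (pi : unitaryRep R G) (f : T) (v : pi) : pi :=
  ga_eval (@rep_act R G pi) f v.

(* ||f||_u = sup of ||pi(f)|| over all unitary representations pi of G. *)
Definition univ_norm (f : T) : R :=
  repnorm (fun pi : unitaryRep R G => hilbert_ip pi) rep_eval f.

Let inh : inhabited (unitaryRep R G).
Proof. exact: (inhabits (trivialRep R G)). Qed.
Let evD (pi : unitaryRep R G) f h (v : pi) :
  rep_eval (f + h) v = rep_eval f v + rep_eval h v.
Proof. exact: ga_evalD. Qed.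
Let evZ (pi : unitaryRep R G) (c : C) f (v : pi) :
  rep_eval (c *: f) v = c *: rep_eval f v.
Proof. exact: ga_evalZ. Qed.
Let evM (pi : unitaryRep R G) f h (v : pi) :
  rep_eval (amul f h) v = rep_eval f (rep_eval h v).
Proof. apply: ga_evalM; [exact: rep_linear|exact: repM]. Qed.
Let evZr (pi : unitaryRep R G) (c : C) f (v : pi) :
  rep_eval f (c *: v) = c *: rep_eval f v.
Proof. apply: ga_eval_actZ; exact: rep_linear. Qed.

Let act_ip (pi : unitaryRep R G) g (u v : pi) :
  hilbert_ip pi (rep_act g u) v = hilbert_ip pi u (rep_act g^-1%g v).
Proof. by rewrite -(rep_unitary g u) -repM mulgV rep1. Qed.

Let evS (pi : unitaryRep R G) f (u v : pi) :
  hilbert_ip pi (rep_eval f u) v = hilbert_ip pi u (rep_eval (astar f) v).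
Proof.
have -> : rep_eval (astar f) v = \sum_(g <- supp f) (f g)^* *: rep_act g^-1%g v.
  rewrite /rep_eval /ga_eval (@reindex_fsbigT _ _ _ _ _ (fun g => g^-1%g)); last first.
    by exists (fun g => g^-1%g) => z; rewrite invgK.
  under eq_fsbigr do rewrite /= invgK.
  by apply: fsbigTE => g /suppPn ->; rewrite rmorph0 scale0r.
rewrite /rep_eval ga_evalE.
elim: (enum_fset (supp f)) => [|g s IH].
  by rewrite !big_nil linear0l linear0r.
rewrite !big_cons linearDl linearDr linearZl_LR linearZr_LR /= conjCK IH.
by rewrite act_ip.
Qed.

Let act_norm (pi : unitaryRep R G) g (v : pi) :
  dnorm (hilbert_ip pi) (rep_act g v) = dnorm (hilbert_ip pi) v.
Proof. by rewrite /dnorm rep_unitary. Qed.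

Let ev_bd f : exists M, forall (pi : unitaryRep R G) (v : pi),
  dnorm (hilbert_ip pi) v <= 1 -> dnorm (hilbert_ip pi) (rep_eval f v) <= M.
Proof.
exists (\sum_(g <- supp f) normc (f g)) => pi v v1; rewrite /rep_eval ga_evalE.
elim: (enum_fset (supp f)) => [|g s IH]; first by rewrite !big_nil dnorm0.
rewrite !big_cons (le_trans (ler_dnormD _ _ _))// lerD// dnormrZ act_norm.
by rewrite ler_piMr ?normc_ge0.
Qed.

HB.instance Definition _ := StarAlgebra_isPreCstar.Build R T
  (repnorm_ge0 inh ev_bd)
  (repnormD inh evD ev_bd)
  (repnormZ inh evZ ev_bd)
  (repnormM inh evM evZr ev_bd)
  (repnorm_cstar inh evM evS evZr ev_bd).

Lemma snorm_univ f : snorm f = univ_norm f.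
Proof. by []. Qed.

(* The full group C*-algebra C^*(G), the completion of C[G] for ||.||_u. *)
Definition groupCstar := completion T.
HB.instance Definition _ := StarAlgebra.on groupCstar.

Definition augm (f : T) : C := \sum_(g \in [set: G]) f g.

Let augmE f : augm f = rep_eval (pi := trivialRep R G) f (1 : C).
Proof. by apply: eq_fsbigr => g _ /=; rewrite -[RHS]/(f g * 1) mulr1. Qed.
Lemma augmD f h : augm (f + h) = augm f + augm h.
Proof. by rewrite !augmE evD. Qed.
Lemma augmZ (c : C) f : augm (c *: f) = c * augm f.
Proof. by rewrite !augmE evZ. Qed.
Lemma augmM f h : augm (amul f h) = augm f * augm h.
Proof.
rewrite (augmE (amul _ _)) evM -[rep_eval h _](mulr1 _) -augmE.
by rewrite (evZr (pi := trivialRep R G) (augm h) f) -augmE mulrC.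
Qed.
Lemma augmS f : augm (astar f) = (augm f)^*.
Proof.
have := evS (pi := trivialRep R G) f (1 : C) (1 : C).
rewrite -!augmE /= -![cdot _ _ _]/(_ * _) rmorph1 mulr1 mul1r => ->.
by rewrite conjCK.
Qed.
Lemma augm_le f : normc (augm f) <= snorm f.
Proof.
rewrite augmE -cdot_norm.
apply: (@le_repnorm1 R T _ _ (fun pi : unitaryRep R G => hilbert_ip pi) rep_eval ev_bd f
  (trivialRep R G) (1 : C)).
by rewrite /= cdot_norm normc1.
Qed.

(* iota : C^*(G) -> C, the extension by continuity of the augmentation of C[G],
   computed on a sequence representing x. *)
Definition trivial_rep (x : groupCstar) : C :=
  clim (fun n => augm (seq_at (quot_repr (subval x)) n)).

Lemma trivial_rep_cvg (x : groupCstar) (s : bounded_prod (fun=> T)) :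
  quot_pi _ s = subval x -> ccvg (fun n => augm (seq_at s n)) (trivial_rep x).
Proof.
move=> sx; have [t tc tx] := subvalP x.
have augB f h : augm (f - h) = augm f - augm h.
  by rewrite augmD -scaleN1r augmZ mulN1r.
have ct : ccvg (fun n => augm (seq_at t n)) (clim (fun n => augm (seq_at t n))).
  apply: ccauchy_cvg => e /tc[N tN]; exists N => m n Nm Nn.
  by rewrite -augB (le_lt_trans (augm_le _))// tN.
have any r : quot_pi _ r = subval x ->
    ccvg (fun n => augm (seq_at r n)) (clim (fun n => augm (seq_at t n))).
  rewrite -tx => /quotAlgE /= rt.
  have d0 : ccvg (fun n => augm (seq_at r n) - augm (seq_at t n)) 0.
    apply/ccvgP; apply: (squeeze_cvgr _ (cvg_cst 0) rt).
    apply: nearW => n; rewrite normc_ge0 subr0 -augB.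
    exact: augm_le.
  have := ccvgD d0 ct; rewrite add0r.
  by under eq_fun do rewrite subrK.
suff -> : trivial_rep x = clim (fun n => augm (seq_at t n)) by exact: any.
by apply: ccvg_lim; apply: any; exact: quot_reprK.
Qed.

Lemma trivial_repP (x : groupCstar) (s : bounded_prod (fun=> T)) (l : C) :
  quot_pi _ s = subval x -> ccvg (fun n => augm (seq_at s n)) l ->
  trivial_rep x = l.
Proof.
by move=> /trivial_rep_cvg/ccvg_lim <- /ccvg_lim <-.
Qed.

Lemma trivial_repD x y : trivial_rep (x + y) = trivial_rep x + trivial_rep y.
Proof.
have rx := quot_reprK (subval x); have ry := quot_reprK (subval y).
apply: (trivial_repP (s := quot_repr (subval x) + quot_repr (subval y))).
  by rewrite quot_piD rx ry.
have := ccvgD (trivial_rep_cvg rx) (trivial_rep_cvg ry).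
by under eq_fun do rewrite -augmD.
Qed.
Lemma trivial_repZ (c : C) x : trivial_rep (c *: x) = c * trivial_rep x.
Proof.
have rx := quot_reprK (subval x).
apply: (trivial_repP (s := c *: quot_repr (subval x))).
  by rewrite quot_piZ rx.
have := ccvgM (ccvg_cst c) (trivial_rep_cvg rx).
by under eq_fun do rewrite -augmZ.
Qed.
Lemma trivial_repM x y : trivial_rep (amul x y) = trivial_rep x * trivial_rep y.
Proof.
have rx := quot_reprK (subval x); have ry := quot_reprK (subval y).
apply: (trivial_repP (s := amul (quot_repr (subval x)) (quot_repr (subval y)))).
  by rewrite quot_piM rx ry.
have := ccvgM (trivial_rep_cvg rx) (trivial_rep_cvg ry).
by under eq_fun do rewrite -augmM.
Qed.
Lemma trivial_repS x : trivial_rep (astar x) = (trivial_rep x)^*.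
Proof.
have rx := quot_reprK (subval x).
apply: (trivial_repP (s := astar (quot_repr (subval x)))).
  by rewrite quot_piS rx.
have := ccvg_conj (trivial_rep_cvg rx).
by under eq_fun do rewrite -augmS.
Qed.

Definition trivial_ker : set groupCstar := [set x | trivial_rep x = 0].
Fact trivial_ker0 : trivial_ker 0.
Proof.
by rewrite /trivial_ker /= -(scale0r (0 : groupCstar)) trivial_repZ mul0r.
Qed.
Fact trivial_kerD x y : trivial_ker x -> trivial_ker y -> trivial_ker (x + y).
Proof. by move=> x0 y0; rewrite /trivial_ker /= trivial_repD x0 y0 addr0. Qed.
Fact trivial_kerZ (c : C) x : trivial_ker x -> trivial_ker (c *: x).
Proof. by move=> x0; rewrite /trivial_ker /= trivial_repZ x0 mulr0. Qed.
Fact trivial_kerM x y : trivial_ker x -> trivial_ker y -> trivial_ker (amul x y).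
Proof. by move=> x0 y0; rewrite /trivial_ker /= trivial_repM x0 mul0r. Qed.
Fact trivial_kerS x : trivial_ker x -> trivial_ker (astar x).
Proof. by move=> x0; rewrite /trivial_ker /= trivial_repS x0 rmorph0. Qed.
(* I(G), the kernel of iota. *)
Definition augmentation_ideal := subAlg (StarSubalg trivial_ker0 trivial_kerD
  trivial_kerZ trivial_kerM trivial_kerS).
HB.instance Definition _ := StarAlgebra.on augmentation_ideal.
End UniversalNorm.

Section MatrixAlg.
Variables (R : realType) (n : nat).
Local Notation M := ('M[R[i]]_n).
Implicit Types A B : M.

Definition adjmx A : M := map_mx conjC A^T.

Fact adjmxK : involutive adjmx.
Proof. by move=> A; apply/matrixP => i j; rewrite !mxE conjCK. Qed.
Fact adjmxD : {morph adjmx : A B / A + B}.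
Proof. by move=> A B; apply/matrixP => i j; rewrite !mxE rmorphD. Qed.
Fact adjmxZ (c : R[i]) A : adjmx (c *: A) = c^* *: adjmx A.
Proof. by apply/matrixP => i j; rewrite !mxE rmorphM. Qed.
Fact adjmxM A B : adjmx (A *m B) = adjmx B *m adjmx A.
Proof. by rewrite /adjmx trmx_mul map_mxM. Qed.
HB.instance Definition _ := Lmodule_isStarAlgebra.Build R M
  (@mulmxA _ n n n n) (fun A B D => mulmxDl A B D) (fun A B D => mulmxDr A B D)
  (fun c A B => esym (scalemxAl c A B)) (fun c A B => esym (scalemxAr c A B))
  adjmxK adjmxD adjmxZ adjmxM.
End MatrixAlg.

Section VectorDot.
Variables (R : realType) (n : nat).
Local Notation C := (R[i]).
Local Notation V := ('cV[R[i]]_n).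
Definition vip (u v : V) : C := \sum_i u i 0 * (v i 0)^*.
Fact vip_addl v : zmod_morphism (vip^~ v).
Proof.
by move=> x y; rewrite /vip -sumrB; apply: eq_bigr => i _; rewrite !mxE mulrBl.
Qed.
Fact vip_addr u : zmod_morphism (vip u).
Proof.
by move=> x y; rewrite /vip -sumrB; apply: eq_bigr => i _; rewrite !mxE rmorphB mulrBr.
Qed.
Fact vip_scalel v : scalable_for *%R (vip^~ v).
Proof.
by move=> c x; rewrite /vip mulr_sumr; apply: eq_bigr => i _; rewrite !mxE mulrA.
Qed.
Fact vip_scaler u : scalable_for (conjC \; *%R) (vip u).
Proof.
move=> c x; rewrite /vip /= mulr_sumr; apply: eq_bigr => i _.
by rewrite !mxE rmorphM mulrCA.
Qed.
HB.instance Definition _ := isBilinear.Build C V V C *%R (conjC \; *%R) vip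
  vip_addl vip_addr vip_scalel vip_scaler.
Fact vip_herm (x y : V) : vip x y = (-1) ^+ false * conjC (vip y x).
Proof.
rewrite expr0 mul1r /vip rmorph_sum; apply: eq_bigr => i _.
by rewrite rmorphM /= conjCK mulrC.
Qed.
HB.instance Definition _ := isHermitianSesquilinear.Build C V false conjC vip vip_herm.
Fact vip_gt0 (u : V) : u != 0 -> 0 < vip u u.
Proof.
move=> u0; rewrite lt_def sumr_ge0 ?andbT => [|i _]; last exact: mul_conjC_ge0.
apply: contra u0; rewrite psumr_eq0 => [/allP u0|i _]; last exact: mul_conjC_ge0.
apply/eqP/matrixP => i j; rewrite ord1 mxE.
by have := u0 i (mem_index_enum _); rewrite mul_conjC_eq0 => /eqP.
Qed.
HB.instance Definition _ := isDotProduct.Build C V vip vip_gt0.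
Definition vdot : {dot V for conjC} := vip.

Lemma vdot_adj (A : 'M[R[i]]_n) u v : vdot (A *m u) v = vdot u (adjmx A *m v).
Proof.
rewrite /= /vip; under eq_bigr do rewrite mxE mulr_suml.
rewrite exchange_big; apply: eq_bigr => j _; rewrite mxE rmorph_sum mulr_sumr.
apply: eq_bigr => i _; rewrite !mxE rmorphM /= conjCK mulrA; congr (_ * _).
by rewrite mulrC.
Qed.

Lemma vdot_coord (v : V) i : normc (v i 0) <= dnorm vdot v.
Proof.
rewrite -(@ler_pXn2r _ 2) ?nnegrE ?normc_ge0 ?dnormr_ge0// dnorm2 /= /vip (bigD1 i)//=.
have ReD (x y : R[i]) : complex.Re (x + y) = complex.Re x + complex.Re y.
  by case: x y => [a b] [c d].
rewrite ReD -[leLHS]addr0 lerD//.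
  case: (v i 0) => a b /=; rewrite sqr_sqrtr ?addr_ge0 ?sqr_ge0//.
  by rewrite mulrN opprK -!expr2.
elim/big_ind: _ => //= [x y|j _]; first by rewrite ReD; exact: addr_ge0.
by have := mul_conjC_ge0 (v j 0); rewrite lecE => /andP[].
Qed.

Lemma dnorm_sum (I : Type) (s : seq I) (F : I -> V) :
  dnorm vdot (\sum_(i <- s) F i) <= \sum_(i <- s) dnorm vdot (F i).
Proof.
elim: s => [|i s IH]; first by rewrite !big_nil dnorm0.
by rewrite !big_cons (le_trans (ler_dnormD _ _ _))// lerD2l.
Qed.

Lemma dnorm_delta i : dnorm vdot (delta_mx i 0) = 1.
Proof.
rewrite /dnorm /= /vip (bigD1 i)//= big1 => [|j ji].
  by rewrite addr0 mxE !eqxx mulr1n conjC1 mulr1 /= sqrtr1.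
by rewrite !mxE (negPf ji) mul0r.
Qed.

Lemma dnorm_mulmx (A : 'M[R[i]]_n) v : dnorm vdot v <= 1 ->
  dnorm vdot (A *m v) <= \sum_i \sum_j normc (A i j).
Proof.
move=> v1; have -> : A *m v = \sum_i \sum_j (A i j * v j 0) *: delta_mx i 0.
  apply/matrixP => i k; rewrite ord1 [LHS]mxE summxE [RHS](bigD1 i)//=.
  rewrite [X in _ + X]big1 => [|j ji]; last first.
    by rewrite summxE big1// => l _; rewrite !mxE eq_sym (negPf ji) mulr0.
  by rewrite addr0 summxE; apply: eq_bigr => j _; rewrite !mxE !eqxx mulr1.
rewrite (le_trans (dnorm_sum _ _))// ler_sum// => i _.
rewrite (le_trans (dnorm_sum _ _))// ler_sum// => j _.
rewrite dnormrZ dnorm_delta mulr1 normcM ler_piMr ?normc_ge0//.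
exact: le_trans (vdot_coord _ _) v1.
Qed.
End VectorDot.

Section Cone.
Variables (R : realType) (n : nat).
Local Notation C := (R[i]).
Local Notation F := (prodAlg (fun _ : R => 'M[R[i]]_n : starAlgType R)).

Definition ccontinuous01 (u : R -> C) :=
  {within `[0, 1], continuous (fun t => complex.Re (u t))} /\
  {within `[0, 1], continuous (fun t => complex.Im (u t))}.

(* C_0((0, 1], M_n(C)): a function on [0, 1] vanishing at 0 is represented by its
   extension by 0 to R, so that equality of functions is equality on [0, 1]. *)
Definition cone_set : set F := [set f |
  (forall i j, ccontinuous01 (fun t => (f t : 'M[R[i]]_n) i j)) /\
  (forall t : R, ~~ (0 < t <= 1) -> f t = 0)].

Let cont_eq u v : u =1 v -> ccontinuous01 v -> ccontinuous01 u.
Proof. by move=> /funext ->. Qed.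
Let contD u v : ccontinuous01 u -> ccontinuous01 v ->
  ccontinuous01 (fun t => u t + v t).
Proof.
have ReD (x y : R[i]) : complex.Re (x + y) = complex.Re x + complex.Re y.
  by case: x y => [a b] [c d].
have ImD (x y : R[i]) : complex.Im (x + y) = complex.Im x + complex.Im y.
  by case: x y => [a b] [c d].
move=> [u1 u2] [v1 v2]; split.
  rewrite (funext (fun t => ReD (u t) (v t))) => x; apply: cvgD; [exact: u1|exact: v1].
rewrite (funext (fun t => ImD (u t) (v t))) => x; apply: cvgD; [exact: u2|exact: v2].
Qed.
Let contM u v : ccontinuous01 u -> ccontinuous01 v ->
  ccontinuous01 (fun t => u t * v t).
Proof.
have ReM (x y : R[i]) : complex.Re (x * y) =
  complex.Re x * complex.Re y - complex.Im x * complex.Im y.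
  by case: x y => [a b] [c d].
have ImM (x y : R[i]) : complex.Im (x * y) =
  complex.Re x * complex.Im y + complex.Im x * complex.Re y.
  by case: x y => [a b] [c d].
move=> [u1 u2] [v1 v2]; split.
  rewrite (funext (fun t => ReM (u t) (v t))) => x.
  by apply: cvgB; apply: cvgM; [exact: u1|exact: v1|exact: u2|exact: v2].
rewrite (funext (fun t => ImM (u t) (v t))) => x.
by apply: cvgD; apply: cvgM; [exact: u1|exact: v2|exact: u2|exact: v1].
Qed.
Let cont_cst c : ccontinuous01 (fun=> c).
Proof. by split=> x; exact: cvg_cst. Qed.
Let cont_conj u : ccontinuous01 u -> ccontinuous01 (fun t => (u t)^*).
Proof.
have ReC (x : R[i]) : complex.Re x^* = complex.Re x by case: x.
have ImC (x : R[i]) : complex.Im x^* = - complex.Im x by case: x.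
move=> [u1 u2]; split.
  by rewrite (funext (fun t => ReC (u t))).
by rewrite (funext (fun t => ImC (u t))) => x; apply: cvgN; exact: u2.
Qed.
Let cont_sum (I : Type) (s : seq I) (u : I -> R -> C) :
  (forall i, ccontinuous01 (u i)) -> ccontinuous01 (fun t => \sum_(i <- s) u i t).
Proof.
move=> uc; elim: s => [|i s IH].
  by apply: (cont_eq (v := fun=> 0)) => [t|]; [rewrite big_nil|exact: cont_cst].
by apply: cont_eq (contD (uc i) IH) => t; rewrite big_cons.
Qed.

Fact cone0 : cone_set 0.
Proof.
split=> // i j; have -> : (fun t => ((0 : F) t : 'M[R[i]]_n) i j) = fun=> 0.
  by apply/funext => t; rewrite mxE.
exact: cont_cst.
Qed.
Fact coneD f g : cone_set f -> cone_set g -> cone_set (f + g).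
Proof.
move=> [fc f0] [gc g0]; split=> [i j|t t01]; last by rewrite prodAlgD f0 ?g0 ?addr0.
by apply: cont_eq (contD (fc i j) (gc i j)) => t; rewrite prodAlgD mxE.
Qed.
Fact coneZ (c : C) f : cone_set f -> cone_set (c *: f).
Proof.
move=> [fc f0]; split=> [i j|t t01]; last by rewrite prodAlgZ f0 ?scaler0.
by apply: cont_eq (contM (cont_cst c) (fc i j)) => t; rewrite prodAlgZ mxE.
Qed.
Fact coneM f g : cone_set f -> cone_set g -> cone_set (amul f g).
Proof.
move=> [fc f0] [gc g0]; split=> [i j|t t01]; last by rewrite prodAlgM f0 ?amul0l.
apply: cont_eq (cont_sum _ (fun k => contM (fc i k) (gc k j))) => t.
by rewrite prodAlgM mxE.
Qed.
Fact coneS f : cone_set f -> cone_set (astar f).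
Proof.
move=> [fc f0]; split=> [i j|t t01]; last by rewrite prodAlgS f0 ?astar0.
by apply: cont_eq (cont_conj (fc j i)) => t; rewrite prodAlgS !mxE.
Qed.
Definition cone := subAlg (StarSubalg cone0 coneD coneZ coneM coneS).
HB.instance Definition _ := StarAlgebra.on cone.

Definition cone_at (f : cone) (t : R) : 'M[R[i]]_n := (subval f : F) t.
Definition cone_eval (t : R) (f : cone) (v : 'cV[R[i]]_n) := cone_at f t *m v.
(* The sup norm sup_t ||f(t)||, for the operator norm on M_n(C) acting on C^n. *)
Definition cone_norm (f : cone) : R := repnorm (fun _ : R => vdot R n) cone_eval f.

Let inh : inhabited R. Proof. exact: (inhabits 0). Qed.
Let evD (t : R) f g v : cone_eval t (f + g) v = cone_eval t f v + cone_eval t g v.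
Proof. exact: mulmxDl. Qed.
Let evZ (t : R) (c : C) f v : cone_eval t (c *: f) v = c *: cone_eval t f v.
Proof. by rewrite /cone_eval scalemxAl. Qed.
Let evM (t : R) f g v : cone_eval t (amul f g) v = cone_eval t f (cone_eval t g v).
Proof. by rewrite /cone_eval mulmxA. Qed.
Let evS (t : R) f u v :
  vdot R n (cone_eval t f u) v = vdot R n u (cone_eval t (astar f) v).
Proof. exact: vdot_adj. Qed.
Let evZr (t : R) (c : C) f v : cone_eval t f (c *: v) = c *: cone_eval t f v.
Proof. by rewrite /cone_eval scalemxAr. Qed.
Let ev_bd f : exists M, forall (t : R) v,
  dnorm (vdot R n) v <= 1 -> dnorm (vdot R n) (cone_eval t f v) <= M.
Proof.
have [fc f0] := subvalP f.
have bd i j : exists M, forall t, normc (cone_at f t i j) <= M.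
  have bd1 (g : R -> R) : {within `[0, 1], continuous g} ->
      exists M, forall t, t \in `[0, 1] -> `|g t| <= M.
    move=> gc; have [c c01 gcm] := @EVT_max R g 0 1 ler01 gc.
    have [d d01 gdm] := @EVT_min R g 0 1 ler01 gc.
    exists (Num.max (g c) (- g d)) => t t01.
    by rewrite ler_norml le_max gcm// lerNl le_max lerN2 gdm// orbT.
  have [gc1 gc2] := fc i j.
  have [M1 M1P] := bd1 _ gc1; have [M2 M2P] := bd1 _ gc2.
  exists (Num.max 0 (M1 + M2)) => t; rewrite le_max.
  have [t01|t01] := boolP (0 < t <= 1); last first.
    by rewrite /cone_at f0// mxE normc0 lexx.
  apply/orP; right; rewrite (le_trans (normc_le _))// lerD//.
    by apply: M1P; rewrite in_itv /=; case/andP: t01 => /ltW -> ->.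
  by apply: M2P; rewrite in_itv /=; case/andP: t01 => /ltW -> ->.
pose M i j := projT1 (cid (bd i j)).
exists (\sum_i \sum_j M i j) => t v v1; rewrite (le_trans (dnorm_mulmx _ v1))//.
apply: ler_sum => i _; apply: ler_sum => j _.
exact: (projT2 (cid (bd i j))).
Qed.
HB.instance Definition _ := StarAlgebra_isPreCstar.Build R cone
  (repnorm_ge0 inh ev_bd)
  (repnormD inh evD ev_bd)
  (repnormZ inh evZ ev_bd)
  (repnormM inh evM evZr ev_bd)
  (repnorm_cstar inh evM evS evZr ev_bd).
End Cone.

(* A *-homomorphism between C*-algebras is an algebraic notion (continuity is
   automatic), so connectivity only involves the underlying *-algebras. The
   notion is meant for separable nuclear C*-algebras, such as I(G) for G
   countable amenable. The factor of index n is C_0((0, 1], M_{n+1}(C)). *)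
Record starHom (R : realType) (A B : starAlgType R) := StarHom {
  starhom_fun :> A -> B;
  starhom_linear : linear starhom_fun;
  starhomM : {morph starhom_fun : x y / amul x y};
  starhomS : {morph starhom_fun : x / astar x} }.

Definition connective (R : realType) (A : starAlgType R) :=
  exists f : starHom A (prod_mod_sum (fun n => cone R n.+1)), injective f.

Definition connective_group (R : realType) (G : groupType) :=
  connective (augmentation_ideal R G).

(* Iso(R^k) = R^k x| O(k): (v, A) stands for the isometry x |-> v + A x. *)
Record euclid (R : realType) (k : nat) := Euclid {
  translation : 'cV[R]_k;
  linpart : 'M[R]_k;
  linpart_orth : linpart^T *m linpart = 1%:M }.

Section IsometryGroup.
Variables (R : realType) (k : nat).
Local Notation E := (euclid R k).
Implicit Types x y z : E.

HB.instance Definition _ := gen_eqMixin E.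
HB.instance Definition _ := gen_choiceMixin E.

Lemma euclidP x y : translation x = translation y -> linpart x = linpart y -> x = y.
Proof.
case: x y => [v a aP] [w b bP] /= e e'; subst w b.
by congr Euclid; exact: Prop_irrelevance.
Qed.

Fact euclid_mul_orth x y :
  (linpart x *m linpart y)^T *m (linpart x *m linpart y) = 1%:M.
Proof.
by rewrite trmx_mul mulmxA -(mulmxA (linpart y)^T) linpart_orth mulmx1 linpart_orth.
Qed.
Fact euclid_inv_orth x : ((linpart x)^T)^T *m (linpart x)^T = 1%:M.
Proof. by rewrite trmxK; apply: mulmx1C; exact: linpart_orth. Qed.
Fact euclid_one_orth : (1%:M : 'M[R]_k)^T *m 1%:M = 1%:M.
Proof. by rewrite trmx1 mulmx1. Qed.

Definition euclid_mul x y : E :=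
  @Euclid R k (translation x + linpart x *m translation y) _ (euclid_mul_orth x y).
Definition euclid_one : E := @Euclid R k 0 _ euclid_one_orth.
Definition euclid_inv x : E :=
  @Euclid R k (- ((linpart x)^T *m translation x)) _ (euclid_inv_orth x).

Fact euclid_mulA : associative euclid_mul.
Proof.
move=> x y z; apply: euclidP; rewrite /= ?mulmxA//.
by rewrite mulmxDr addrA mulmxA.
Qed.
Fact euclid_mul1 : left_id euclid_one euclid_mul.
Proof. by move=> x; apply: euclidP; rewrite /= ?mul1mx ?add0r. Qed.
Fact euclid_1mul : right_id euclid_one euclid_mul.
Proof. by move=> x; apply: euclidP; rewrite /= ?mulmx1 ?mulmx0 ?addr0. Qed.
Fact euclid_mulV : left_inverse euclid_one euclid_inv euclid_mul.
Proof.
by move=> x; apply: euclidP; rewrite /= ?linpart_orth// addrC subrr.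
Qed.
Fact euclid_Vmul : right_inverse euclid_one euclid_inv euclid_mul.
Proof.
move=> x; apply: euclidP; rewrite /= ?mulmxN ?mulmxA.
  by have := euclid_inv_orth x; rewrite trmxK => ->; rewrite mul1mx subrr.
by have := euclid_inv_orth x; rewrite trmxK.
Qed.
HB.instance Definition _ := isGroup.Build E
  euclid_mulA euclid_mul1 euclid_1mul euclid_mulV euclid_Vmul.

(* The topology induced by R^k x M_k(R). *)
HB.instance Definition _ := Topological.copy E
  (initial_topology (fun x : E => (translation x, linpart x))).
End IsometryGroup.

Section Crystallographic.
Variables (R : realType) (k : nat) (H : groupClosed (euclid R k)).
Local Open Scope quotient_scope.

Definition coset_rel : rel (euclid R k) := fun x y => (x^-1 * y)%g \in H.
Fact coset_rel_refl : reflexive coset_rel.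
Proof. by move=> x; rewrite /coset_rel mulVg gpred1. Qed.
Fact coset_rel_sym : symmetric coset_rel.
Proof. by move=> x y; rewrite /coset_rel -gpredV invgM invgK. Qed.
Fact coset_rel_trans : transitive coset_rel.
Proof.
move=> y x z; rewrite /coset_rel => xy yz.
have -> : (x^-1 * z = (x^-1 * y) * (y^-1 * z))%g.
  by rewrite mulgA -(mulgA _ y) mulgV mulg1.
exact: gpredM.
Qed.
Canonical coset_equiv :=
  EquivRel coset_rel coset_rel_refl coset_rel_sym coset_rel_trans.

(* Discrete, with compact quotient space Iso(R^k) / H. *)
Definition crystallographic :=
  (forall x, x \in H -> isolated [set` H] x) /\
  compact [set: quotient_topology {eq_quot coset_equiv}].
End Crystallographic.

Definition torsion_free (G : groupType) :=
  forall (g : G) (n : nat), (0 < n)%N -> (g ^+ n = 1)%g -> g = 1%g.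

(* G is a Bieberbach group if it is isomorphic to a torsion-free crystallographic
   subgroup of some Iso(R^k), k >= 1. *)
Definition bieberbach (R : realType) (G : groupType) := torsion_free G /\
  exists k : nat, (0 < k)%N /\ exists H : groupClosed (euclid R k),
    crystallographic H /\
    exists phi : G -> euclid R k,
      [/\ {morph phi : g h / (g * h)%g}, injective phi & range phi = [set` H]].

(* [G, G], the subgroup generated by the commutators. *)
Definition derived (G : groupType) : set G :=
  [set x | forall K : groupClosed G, (forall a b : G, [~ a, b]%g \in K) -> x \in K].
Arguments derived G : clear implicits.

(* H_1(G, Z) = G / [G, G], as a set of cosets. *)
Definition H1 (G : groupType) : set (set G) :=
  [set [set (g * c)%g | c in derived G] | g in [set: G]].
Arguments H1 G : clear implicits.

(* Main.v *)
(* Suppose that u is a unitary representation of G with |u(s) - 1| <= c for all s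
   in a finite generating set S. A commutator [u, v] differs from 1 by at most
   O(|u - 1| |v - 1|), so |u(g) - 1| = O(c^2) for every g in [G, G]. As H_1(G) is
   finite, s^m lies in [G, G] for some m > 0, and u(s)^m - 1 = m (u(s) - 1) + O(c^2),
   so |u(s) - 1| <= C c^2: representations of a finitely generated group with
   finite H_1 that are norm-close to the trivial one are trivial on G.
   An embedding of I(G) in the cone quotient provides asymptotically multiplicative
   paths t |-> u_n(t) starting at the trivial representation. By the gap between
   c = 0 and c >= 1/C, such paths cannot leave a neighbourhood of it, so every
   s - 1 is mapped to 0 and the embedding forces s = 1 in C*(G). It then suffices
   to test this on the linear parts: they are all trivial, so G is abelian, hence
   torsion, hence trivial, which contradicts cocompactness. Finite generation is
   the usual argument: translation parts are r-dense by cocompactness, and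
   elements with translation part of length at most 2 r + 1 generate. *)

Require Import Defs.
From HB Require Import structures.
From mathcomp Require Import all_boot all_order all_algebra.
From mathcomp Require Import finmap.
From mathcomp.real_closed Require Import complex.
From mathcomp Require Import all_classical all_reals all_analysis.
From mathcomp Require Import ring lra.

Set Implicit Arguments.
Unset Strict Implicit.
Unset Printing Implicit Defensive.

Import Order.TTheory GRing.Theory Num.Theory.
Import numFieldNormedType.Exports.
Import ComplexField.Normc.

Local Open Scope classical_set_scope.
Local Open Scope ring_scope.

(** * The commutator subgroup and finite abelianization *)

Section DerivedSubgroup.
Variable G : groupType.
Local Open Scope group_scope.

(** Since [derived] is an intersection of subgroups, the predicate is packed as a subgroup
    containing the commutators. *)
Lemma derived_ind (P : G -> Prop) :
  P 1 -> (forall x y, P x -> P y -> P (x * y)) -> (forall x, P x -> P x^-1) ->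
  (forall a b, P [~ a, b]) -> forall x, derived G x -> P x.
Proof.
move=> P1 PM PV PR x /=.
pose K : {pred G} := fun y => `[< P y >].
have KV : invg_closed K by move=> y /asboolP Py; apply/asboolP/PV.
have KM : mulg_closed K.
  by move=> y z /asboolP Py /asboolP Pz; apply/asboolP/PM.
have K1 : 1 \in K by apply/asboolP.
pose KG : groupClosed G := HB.pack_for (groupClosed G) K
  (isInvClosed.Build G K KV) (isMul1Closed.Build G K K1)
  (isMulClosed.Build G K KM).
by move=> /(_ KG (fun a b => asboolT (PR a b)))/asboolP.
Qed.

(** Pigeonhole on the cosets [c i] of the powers of [g]: if [c i = c j] with [i < j], then
    [m = j - i] works. *)
Lemma derived_exponent (g : G) :
  finite_set (H1 G) -> exists2 m : nat, (0 < m)%N & derived G (g ^+ m).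
Proof.
move=> fin.
pose c (i : nat) : set G := [set g ^+ i * x | x in derived G].
have d1 : derived G 1 by move=> K _; exact: gpred1.
have [i [j [ij cij]]] : exists i j : nat, (i < j)%N /\ c i = c j.
  apply: contrapT => no; apply: infinite_nat.
  have -> : [set: nat] = c @^-1` H1 G.
    by apply/seteqP; split=> // i _; exists (g ^+ i).
  apply: finite_preimage fin => i j _ _ cij; apply: contrapT => /eqP.
  by rewrite neq_ltn => /orP[] ij; apply: no; [exists i, j|exists j, i].
exists (j - i)%N; first by rewrite subn_gt0.
have : c i (g ^+ j) by rewrite cij; exists 1; rewrite ?mulg1.
move=> [x xD xj]; suff -> : g ^+ (j - i)%N = x by [].
by apply: (mulgI (g ^+ i)); rewrite xj -expgnDr subnKC// ltnW.
Qed.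

End DerivedSubgroup.

(** * The quadratic estimate *)

Section QuadraticEstimate.
Variables (R : realType) (A : starAlgType R).

(* [B a r] abstracts ``a has seminorm at most r'', for a submultiplicative
   seminorm. *)
Record seminorm_bound (B : A -> R -> Prop) : Prop := SeminormBound {
  bound0 : B 0 0;
  bound_le : forall a r s, r <= s -> B a r -> B a s;
  boundD : forall a b r s, B a r -> B b s -> B (a + b) (r + s);
  boundZ : forall (c : R[i]) a r, B a r -> B (c *: a) (normc c * r);
  boundM : forall a b r s, B a r -> B b s -> B (amul a b) (r * s) }.

(* [x g] stands for [u g - 1], where [u] is a multiplicative map with values in
   the unitization of [A]. *)
Variables (G : groupType) (x : G -> A) (S : seq G).
Hypothesis x1 : x 1%g = 0.
Hypothesis xM : forall g h, x (g * h)%g = amul (x g) (x h) + x g + x h.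
Hypothesis genS : forall P : G -> Prop, P 1%g ->
  (forall s g, s \in S -> P g -> P (g * s)%g) -> forall g, P g.

(** The condition [c <= 1] lets higher powers of [c] be absorbed into lower ones. *)
Definition small (B : A -> R -> Prop) (c : R) :=
  [/\ seminorm_bound B, 0 <= c <= 1 & forall s, s \in S -> B (x s) c].

(* [a = O(c ^ k)], uniformly in the seminorm, when the generators [s] satisfy
   [x s = O(c)]. *)
Definition bigO (k : nat) (a : A) :=
  exists2 L : R, 0 <= L & forall B c, small B c -> B a (L * c ^+ k).

Lemma bigO_le k l a : (k <= l)%N -> bigO l a -> bigO k a.
Proof.
move=> kl [L L0 aL]; exists L => // B c sB; have [hB /andP[c0 c1] _] := sB.
by apply: (bound_le hB) (aL _ _ sB); rewrite ler_wpM2l// ler_wiXn2l.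
Qed.

Lemma bigOD k a b : bigO k a -> bigO k b -> bigO k (a + b).
Proof.
move=> [L L0 aL] [M M0 bM]; exists (L + M); first exact: addr_ge0.
move=> B c sB; have [hB _ _] := sB; rewrite mulrDl.
by apply: (boundD hB); [exact: aL|exact: bM].
Qed.

Lemma bigOZ (z : R[i]) k a : bigO k a -> bigO k (z *: a).
Proof.
move=> [L L0 aL]; exists (normc z * L); first by rewrite mulr_ge0 ?normc_ge0.
by move=> B c sB; have [hB _ _] := sB; rewrite -mulrA; apply: (boundZ hB); exact: aL.
Qed.

Lemma bigOB k a b : bigO k a -> bigO k b -> bigO k (a - b).
Proof. by move=> ? ?; rewrite -scaleN1r; apply: bigOD => //; exact: bigOZ. Qed.

Lemma bigOM k l a b : bigO k a -> bigO l b -> bigO (k + l) (amul a b).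
Proof.
move=> [L L0 aL] [M M0 bM]; exists (L * M); first exact: mulr_ge0.
move=> B c sB; have [hB _ _] := sB; rewrite exprD mulrACA.
by apply: (boundM hB); [exact: aL|exact: bM].
Qed.

Lemma bigO0 k : bigO k 0.
Proof. by exists 0 => // B c [hB _ _]; rewrite mul0r; exact: bound0. Qed.

Lemma bigO_xM k g h : bigO k (x g) -> bigO k (x h) -> bigO k (x (g * h)%g).
Proof.
move=> Og Oh; rewrite xM; apply: (bigOD _ Oh); apply: (bigOD _ Og).
by apply: (@bigO_le _ (k + k)); [exact: leq_addr|exact: bigOM].
Qed.

(** Induction on a word for [g]. The constant depends on the word, but on neither [B] nor [c]. *)
Lemma bigO_x g : bigO 1 (x g).
Proof.
elim/genS: g => [|s g sS Og]; first by rewrite x1; exact: bigO0.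
apply: bigO_xM => //.
by exists 1 => // B c [_ _ BS]; rewrite mul1r; exact: BS.
Qed.

(** Solve [x (g * g^-1) = 0] for [x g^-1]; in the product term, the a priori order 1 given by
    [bigO_x] suffices. *)
Lemma bigO_xV k g : bigO k (x g) -> bigO k (x g^-1%g).
Proof.
move=> Og; have := xM g g^-1%g; rewrite mulgV x1 => /esym/eqP.
rewrite addr_eq0 => /eqP/(congr1 -%R); rewrite opprK => <-.
rewrite -scaleN1r; apply/bigOZ/bigOD => //.
by apply: (@bigO_le _ (k + 1)); [exact: leq_addr|apply: bigOM => //; exact: bigO_x].
Qed.

(* From [a b = b a [~ a, b]], the defect of [~ a, b] from 1 is
   [x_a x_b - x_b x_a - x_(b a) x_[~ a, b]], which has only quadratic terms. *)
Lemma bigO2_derived g : derived G g -> bigO 2 (x g).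
Proof.
move: g; apply: derived_ind => [|g h|g|a b].
- by rewrite x1; exact: bigO0.
- exact: bigO_xM.
- exact: bigO_xV.
have eab : (a * b = b * a * [~ a, b])%g.
  by rewrite /commg /conjg !mulgA mulgK mulgV mul1g.
have : x [~ a, b]%g = amul (x a) (x b) - amul (x b) (x a)
                      - amul (x (b * a)%g) (x [~ a, b]%g).
  have e := xM (b * a)%g [~ a, b]%g; rewrite -eab in e.
  transitivity (x (a * b)%g - (amul (x (b * a)%g) (x [~ a, b]%g) + x (b * a)%g)).
    by rewrite e addrAC subrr add0r.
  move: (amul (x (b * a)%g) _) => p.
  rewrite (xM a b) (xM b a) -!(addrA (amul _ _)) (addrC (x b)).
  by rewrite [p + _]addrA opprD [_ + (_ - _)]addrCA subrr addr0 opprD (addrC (- p)).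
move=> ->; apply: bigOB; first apply: bigOB;
  by apply: (@bigOM 1 1); exact: bigO_x.
Qed.

(** First-order expansion of a power: each further factor contributes a product of two terms of
    order 1. *)
Lemma bigO2_expg g m : bigO 2 (x (g ^+ m)%g - m%:R *: x g).
Proof.
elim: m => [|m IH]; first by rewrite expg0 x1 scale0r subrr; exact: bigO0.
have -> : x (g ^+ m.+1)%g - m.+1%:R *: x g
   = amul (x (g ^+ m)%g) (x g) + (x (g ^+ m)%g - m%:R *: x g).
  by rewrite expgSr xM -natr1 scalerDl scale1r opprD addrACA subrr addr0 -addrA.
by apply: bigOD => //; apply: (@bigOM 1 1); exact: bigO_x.
Qed.

(** When [g ^+ m] is in the derived subgroup, [x (g ^+ m)] and its distance to [m x g] both have
    order 2, and [m] can be divided out. *)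
Lemma quadratic_estimate :
  (forall g, exists2 m, (0 < m)%N & derived G (g ^+ m)%g) ->
  exists2 C : R, 0 <= C & forall B c, small B c ->
    forall s, s \in S -> B (x s) (C * c ^+ 2).
Proof.
move=> fin_exp.
have O2 g : bigO 2 (x g).
  have [m m0 Dm] := fin_exp g.
  have -> : x g = m%:R^-1 *: (x (g ^+ m)%g - (x (g ^+ m)%g - m%:R *: x g)).
    rewrite opprB addrC subrK scalerA mulVf ?scale1r//.
    by rewrite pnatr_eq0 -lt0n.
  apply/bigOZ/bigOB; [exact: bigO2_derived|exact: bigO2_expg].
suff [C C0 BC] : exists2 C : R, 0 <= C &
    forall s, s \in S -> forall B c, small B c -> B (x s) (C * c ^+ 2).
  by exists C => // B c sB s sS; exact: BC.
(* Only the list in [s \in S] shrinks: [small] still refers to all of [S]. The constants of the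
   generators add up. *)
elim: S => [|s T [C C0 BC]]; first by exists 0.
have [L L0 sL] := O2 s; exists (L + C); first exact: addr_ge0.
move=> t tT B c sB; have [hB _ _] := sB.
have c2 : 0 <= c ^+ 2 by rewrite sqr_ge0.
move: tT; rewrite inE => /orP[/eqP->|tT].
  by apply: (bound_le hB) (sL _ _ sB); rewrite ler_wpM2r// lerDl.
by apply: (bound_le hB) (BC _ tT _ _ sB); rewrite ler_wpM2r// lerDr.
Qed.
End QuadraticEstimate.

(** * Finite generation of crystallographic groups *)

Section Complexification.
Variable R : realType.

Definition cplx m n (A : 'M[R]_(m, n)) : 'M[R[i]]_(m, n) := map_mx (real_complex R) A.

Lemma cplx_orth_vdot n (A : 'M[R]_n) (u v : 'cV[R[i]]_n) :
  A^T *m A = 1%:M -> vdot R n (cplx A *m u) (cplx A *m v) = vdot R n u v.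
Proof.
move=> AA; rewrite vdot_adj mulmxA.
have -> : adjmx (cplx A) = cplx A^T.
  by apply/matrixP => i j; rewrite !mxE; exact: conjc_real.
by rewrite -map_mxM AA map_mx1 mul1mx.
Qed.

Lemma vdot_norm_le_sum n (v : 'cV[R[i]]_n) :
  dnorm (vdot R n) v <= \sum_i normc (v i 0).
Proof.
rewrite {1}(_ : v = \sum_i v i 0 *: delta_mx i 0); last first.
  apply/matrixP => i j; rewrite ord1 summxE (bigD1 i)//= big1 => [|l li].
    by rewrite !mxE !eqxx mulr1 addr0.
  by rewrite !mxE eq_sym (negPf li) mulr0.
rewrite (le_trans (dnorm_sum _ _))// ler_sum// => i _.
by rewrite dnormrZ dnorm_delta mulr1.
Qed.

(** The Euclidean norm, computed in C^n so that the results on Hermitian dot products apply. *)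
Definition enorm n (v : 'cV[R]_n) : R := dnorm (vdot R n) (cplx v).

Lemma enorm_ge0 n (v : 'cV[R]_n) : 0 <= enorm v.
Proof. exact: dnormr_ge0. Qed.

Lemma enormD n (u v : 'cV[R]_n) : enorm (u + v) <= enorm u + enorm v.
Proof. by rewrite /enorm /cplx map_mxD ler_dnormD. Qed.

Lemma enormZ n (a : R) (v : 'cV[R]_n) : enorm (a *: v) = `|a| * enorm v.
Proof.
rewrite /enorm /cplx map_mxZ dnormrZ /normc /=.
by rewrite expr0n /= addr0 sqrtr_sqr.
Qed.

Lemma enormN n (v : 'cV[R]_n) : enorm (- v) = enorm v.
Proof. by rewrite -scaleN1r enormZ normrN1 mul1r. Qed.

Lemma enorm_orth n (A : 'M[R]_n) (v : 'cV[R]_n) :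
  A^T *m A = 1%:M -> enorm (A *m v) = enorm v.
Proof. by move=> AA; rewrite /enorm /cplx map_mxM /dnorm cplx_orth_vdot. Qed.

Lemma enorm_coord n (v : 'cV[R]_n) i : `|v i 0| <= enorm v.
Proof.
apply: le_trans (vdot_coord (cplx v) i).
by rewrite mxE /normc /= expr0n /= addr0 sqrtr_sqr.
Qed.

Lemma enorm_le_sum n (v : 'cV[R]_n) : enorm v <= \sum_i `|v i 0|.
Proof.
rewrite (le_trans (vdot_norm_le_sum _))//; apply: ler_sum => i _.
by rewrite mxE /normc /= expr0n /= addr0 sqrtr_sqr.
Qed.

(** An entry is a coordinate of the image of a unit basis vector. *)
Lemma orth_entry n (A : 'M[R]_n) i j : A^T *m A = 1%:M -> `|A i j| <= 1.
Proof.
move=> AA; have := enorm_coord (A *m delta_mx j 0) i.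
by rewrite enorm_orth// /enorm /cplx map_delta_mx dnorm_delta -colE mxE.
Qed.
End Complexification.

Section DiscreteCocompact.
Variables (R : realType) (k : nat) (H : groupClosed (euclid R k)).
Local Notation E := (euclid R k).
Local Open Scope quotient_scope.

Lemma translationM (x y : E) :
  translation (x * y)%g = translation x + linpart x *m translation y.
Proof. by []. Qed.

Lemma linpartM (x y : E) : linpart (x * y)%g = linpart x *m linpart y.
Proof. by []. Qed.

Lemma linpartV (x : E) : linpart (x^-1)%g = (linpart x)^T.
Proof. by []. Qed.

Lemma translationVM (x y : E) :
  translation (x^-1 * y)%g = (linpart x)^T *m (translation y - translation x).
Proof. by rewrite translationM mulmxBr addrC. Qed.

(** As [translation x] is the image of the origin under [x], this is invariance of distances under
    [x^-1]. *)
Lemma enorm_translationVM (x y : E) :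
  enorm (translation (x^-1 * y)%g) = enorm (translation y - translation x).
Proof.
rewrite translationVM enorm_orth//; exact: (linpart_orth (x^-1)%g).
Qed.

Definition pure_translation (v : 'cV[R]_k) : E :=
  @Euclid R k v _ (euclid_one_orth R k).

(** The sum of absolute values dominates [enorm], and its continuity is checked coordinate by
    coordinate. *)
Lemma continuous_translation_mul (h : E) :
  continuous (fun x : E => \sum_i `|translation (x * h)%g i 0|).
Proof.
have -> : (fun x : E => \sum_i `|translation (x * h)%g i 0|)
    = (fun p : 'cV[R]_k * 'M[R]_k =>
        \sum_i `|p.1 i 0 + \sum_j p.2 i j * translation h j 0|)
      \o (fun x : E => (translation x, linpart x)).
  by apply/funext => x /=; apply: eq_bigr => i _; rewrite !mxE.
move=> x; apply: continuous_comp; first exact: initial_continuous.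
apply: continuous_big => [|i _ {}x]; first exact: add_continuous.
apply: cvg_norm; apply: cvgD.
  apply: (continuous_comp (f := fst) (g := fun v : 'cV[R]_k => v i 0)).
    exact: cvg_fst.
  exact: coord_continuous.
apply: continuous_big => [|j _ {}x]; first exact: add_continuous.
apply: cvgM; last exact: cvg_cst.
apply: (continuous_comp (f := snd) (g := fun v : 'M[R]_k => v i j)).
  exact: cvg_snd.
exact: coord_continuous.
Qed.

Lemma coset_of_pi (x y : E) :
  \pi_{eq_quot (coset_equiv H)} x = \pi_{eq_quot (coset_equiv H)} y ->
  (x^-1 * y)%g \in H.
Proof. by move/eqP; rewrite eqmodE. Qed.

(** For [x] the translation by [-v], this puts a point of the [H]-orbit of the origin within [r] of
    [v]. The sets [P n] form an increasing open cover of the compact quotient. *)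
Lemma cocompact_dense :
  compact [set: quotient_topology {eq_quot (coset_equiv H)}] ->
  exists r : R, forall x : E,
    exists2 h, h \in H & enorm (translation (x * h)%g) < r.
Proof.
move=> /compact_near_coveringP cov.
pose P (n : nat) (q : quotient_topology {eq_quot (coset_equiv H)}) :=
  exists x h : E,
    [/\ q = \pi x, h \in H & \sum_i `|translation (x * h)%g i 0| < n%:R].
have [|n _ Pn] := cov nat \oo P _.
  move=> q _; elim/quotW: q => x.
  pose N := (Num.truncn (\sum_i `|translation x i 0|)).+1.
  exists ([set q | P N q], [set n | (N <= n)%N]); last first.
    move=> [q n] /= [[y [h [qy hH yN]]] Nn]; exists y, h; split=> //.
    by apply: lt_le_trans yN _; rewrite ler_nat.
  split; last by exists N.
  apply: open_nbhs_nbhs; split; last first.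
    exists x, 1%g; split => //; first exact: gpred1.
    by rewrite mulg1 truncnS_gt.
  rewrite /open /= /quotient_open.
  (* Openness in the quotient is openness of the preimage, here a union over [H] of open sets. *)
  have -> : \pi_(quotient_topology {eq_quot (coset_equiv H)}) @^-1` [set q | P N q]
     = \bigcup_(h in [set` H])
         ((fun x : E => \sum_i `|translation (x * h)%g i 0|) @^-1` [set a | a < N%:R]).
    apply/seteqP; split => [y /= [z [h [yz hH zN]]]|y /= [h hH yN]]; last first.
      by exists y, h.
    have {}yz := coset_of_pi yz.
    exists (y^-1 * z * h)%g; first exact: gpredM.
    by have e : (y * (y^-1 * z * h) = z * h)%g;
      [rewrite !mulgA mulgV mul1g|rewrite -e in zN].
  apply: bigcup_open => h _; apply: open_comp; last exact: open_lt.
  by move=> ? _; exact: continuous_translation_mul.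
exists n%:R => x.
have [y [h [/coset_of_pi xy hH yn]]] := Pn n (leqnn n) (\pi x) I.
exists (x^-1 * y * h)%g; first exact: gpredM.
by rewrite !mulgA mulgV mul1g (le_lt_trans (enorm_le_sum _)).
Qed.

(** An isolating neighbourhood contains the preimage of a ball around [(0, 1%:M)], which yields an
    entrywise test for the identity. *)
Lemma discrete_isolated :
  isolated [set` H] (1%g : E) -> exists2 e : R, 0 < e &
    forall h, h \in H -> (forall i, `|translation h i 0| < e) ->
      (forall i j, `|linpart h i j - (1%:M : 'M[R]_k) i j| < e) -> h = 1%g.
Proof.
move=> [_ [V]]; rewrite nbhsE => -[U [[W oW <-] /= W1] UV] VH.
have : nbhs (0 : 'cV[R]_k, 1%:M : 'M[R]_k) W by apply: open_nbhs_nbhs.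
move=> /nbhs_ballP[e /= e0 eW]; exists e => // h hH he1 he2.
suff : (V `&` [set` H]) h by rewrite VH.
split=> //; apply: UV; apply: eW; split; split=> // i j /=.
  rewrite !ord1 mxE -ball_normE /= sub0r normrN; exact: he1.
by rewrite -ball_normE /= distrC; exact: he2.
Qed.

(** Pigeonhole on a grid: all entries lie in [[-M, M]], and two elements in the same cell satisfy
    [x^-1 * y = 1] by discreteness. *)
Lemma discrete_locally_finite (r : R) :
  isolated [set` H] (1%g : E) ->
  finite_set [set h | h \in H /\ enorm (translation h) <= r].
Proof.
move=> /discrete_isolated[e e0 He]; set S := [set h | _].
(* A sum of [k] errors bounded by [d] stays strictly below [e]. *)
pose d := e / k.+1%:R; have d0 : 0 < d by rewrite divr_gt0.
pose M := Num.max r 1.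
pose N := Num.truncn ((M + M) / d).
(* The index of the cell of mesh [d] containing [a]; [inord] is exact when [|a| <= M]. *)
pose q (a : R) : 'I_N.+1 := inord (Num.truncn ((a + M) / d)).
have q_close a b : `|a| <= M -> `|b| <= M -> q a = q b -> `|a - b| < d.
  move=> aM bM /(congr1 val).
  have qK c : `|c| <= M -> val (q c) = Num.truncn ((c + M) / d).
    rewrite ler_norml => /andP[Mc cM].
    rewrite /= inordK// ltnS; apply: le_truncn.
    by rewrite ler_pM2r ?invr_gt0// lerD2r.
  rewrite !qK// => ab.
  have qlt c : `|c| <= M ->
      (Num.truncn ((c + M) / d))%:R * d <= c + M < (Num.truncn ((c + M) / d))%:R * d + d.
    rewrite ler_norml => /andP[Mc cM].
    have /truncn_itv : 0 <= (c + M) / d by rewrite divr_ge0 ?(ltW d0)// -lerBlDr sub0r.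
    set t := Num.truncn _; rewrite ler_pdivlMr// ltr_pdivrMr//.
    by rewrite -(natr1 t) [(_ + 1) * _]mulrDl mul1r.
  have := qlt a aM; have := qlt b bM; rewrite ab.
  set t := _ * d => /andP[b1 b2] /andP[a1 a2].
  by rewrite ltr_norml; apply/andP; split; lra.
pose f (h : E) : {ffun 'I_k -> 'I_N.+1} * {ffun 'I_k * 'I_k -> 'I_N.+1} :=
  ([ffun i => q (translation h i 0)], [ffun ij => q (linpart h ij.1 ij.2)]).
have inj : {in S &, injective f}.
  move=> x y /set_mem[xH xr] /set_mem[yH yr] [] /ffunP ft /ffunP fl.
  have orth_sum (w : 'cV[R]_k) i :
      (forall j, `|w j 0| < d) -> `|((linpart x)^T *m w) i 0| < e.
    move=> wd; apply: le_lt_trans (enorm_coord _ _) _.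
    rewrite enorm_orth; last exact: (linpart_orth (x^-1)%g).
    apply: le_lt_trans (enorm_le_sum _) _.
    apply: (@le_lt_trans _ _ (\sum_(j < k) d)).
      by apply: ler_sum => j _; exact: ltW.
    rewrite sumr_const card_ord -(mulr_natl d) /d mulrCA gtr_pMr//.
    by rewrite ltr_pdivrMr// mul1r ltr_nat.
  have xy : (x^-1 * y)%g = 1%g.
    apply: He => [|i|i j].
    - by apply: gpredM => //; rewrite gpredV.
    - rewrite translationVM; apply: orth_sum => j; rewrite !mxE; apply: q_close.
      + by rewrite (le_trans (enorm_coord _ _))// le_max yr.
      + by rewrite (le_trans (enorm_coord _ _))// le_max xr.
      + by have := ft j; rewrite !ffunE.
    - rewrite linpartM linpartV -(linpart_orth x) .
      have -> : ((linpart x)^T *m linpart y) i j - ((linpart x)^T *m linpart x) i j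
        = ((linpart x)^T *m col j (linpart y - linpart x)) i 0.
        by rewrite !mxE -sumrB; apply: eq_bigr => l _; rewrite !mxE mulrBr.
      apply: orth_sum => l; rewrite !mxE; apply: q_close.
      + by rewrite le_max orth_entry ?orbT//; exact: linpart_orth.
      + by rewrite le_max orth_entry ?orbT//; exact: linpart_orth.
      + by have := fl (l, j); rewrite !ffunE.
  by rewrite -[RHS](mulVKg x) xy mulg1.
by rewrite -(eq_finite_set (inj_card_eq inj)); exact: finite_finset.
Qed.

(** A long [g] is split as [h * (h^-1 * g)], where [h] carries the origin near a point of the
    segment from 0 to [translation g]. The second factor is short, and [h] is shorter than [g] by at
    least 1, whence the induction on an integer bound. *)
Lemma crystallographic_generated :
  crystallographic H -> exists r : R, forall P : E -> Prop, P 1%g ->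
    (forall s g, s \in H -> enorm (translation s) <= r -> P g -> P (g * s)%g) ->
    forall g, g \in H -> P g.
Proof.
move=> [_ /cocompact_dense[r dense]].
have r0 : 0 < r.
  by have [h _ +] := dense 1%g; apply: le_lt_trans; exact: enorm_ge0.
exists (2 * r + 1) => P P1 PM.
have step (n : nat) g : g \in H -> enorm (translation g) <= n%:R -> P g.
  elim: n g => [|n IH] g gH gn.
    rewrite -(mul1g g); apply: PM => //.
    by rewrite (le_trans gn)// addr_ge0// mulr_ge0// ltW.
  have [small|big] := leP (enorm (translation g)) (2 * r + 1).
    by rewrite -(mul1g g); exact: PM.
  set a := enorm (translation g) in gn big *.
  have a0 : 0 < a by apply: lt_trans big; rewrite addr_gt0// mulr_gt0.
  (* The point of the segment at distance [r + 1] from its end: the error [r] of [h] still leaves a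
     gain of 1. *)
  pose v := (1 - (r + 1) / a) *: translation g.
  have [h hH] := dense (pure_translation (- v)).
  rewrite translationM /= mul1mx addrC => hv.
  have nv : enorm v = a - (r + 1).
    rewrite enormZ -/a ger0_norm; first by rewrite mulrBl mul1r mulfVK// gt_eqF.
    by rewrite subr_ge0 ler_pdivrMr// mul1r; lra.
  have ngv : enorm (translation g - v) = r + 1.
    rewrite /v scalerBl scale1r opprB addrC subrK enormZ -/a.
    rewrite ger0_norm ?divr_ge0 ?mulfVK ?gt_eqF ?(ltW a0)//; lra.
  have -> : g = (h * (h^-1 * g))%g by rewrite mulVKg.
  apply: PM.
  - by apply: gpredM => //; rewrite gpredV.
  - rewrite enorm_translationVM.
    have -> : translation g - translation h = (translation g - v) - (translation h - v).
      by rewrite opprB addrA subrK.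
    by rewrite (le_trans (enormD _ _))// ngv enormN; lra.
  - apply: IH => //; have -> : translation h = (translation h - v) + v by rewrite subrK.
    rewrite (le_trans (enormD _ _))// nv.
    by move: gn; rewrite -natr1; lra.
move=> g gH; apply: (step (Num.truncn (enorm (translation g))).+1) => //.
exact/ltW/truncnS_gt.
Qed.
End DiscreteCocompact.

(** * Paths of matrices and the rigidity argument *)

Section OperatorNorm.
Variables (R : realType) (n : nat).
Local Notation M := ('M[R[i]]_n).

Definition opnorm (A : M) : R :=
  repnorm (A := M) (fun _ : unit => vdot R n) (fun _ B v => B *m v) A.

Let opbounded (A : M) : exists K, forall (i : unit) v,
  dnorm (vdot R n) v <= 1 -> dnorm (vdot R n) (A *m v) <= K.
Proof.
by exists (\sum_i \sum_j normc (A i j)) => _ v v1; exact: dnorm_mulmx.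
Qed.

Lemma opnorm_ge0 A : 0 <= opnorm A.
Proof. exact: (repnorm_ge0 (inhabits tt) opbounded). Qed.

Lemma opnormD A B : opnorm (A + B) <= opnorm A + opnorm B.
Proof.
apply: (repnormD (inhabits tt) _ opbounded) => _ ? ? v; exact: mulmxDl.
Qed.

Lemma opnormZ (c : R[i]) A : opnorm (c *: A) = normc c * opnorm A.
Proof.
apply: (repnormZ (inhabits tt) _ opbounded) => _ ? ? v.
by rewrite scalemxAl.
Qed.

Lemma opnormN A : opnorm (- A) = opnorm A.
Proof. by rewrite -scaleN1r opnormZ normcN normc1 mul1r. Qed.

Lemma opnormM A B : opnorm (A *m B) <= opnorm A * opnorm B.
Proof.
apply: (repnormM (A := M) (inhabits tt) _ _ opbounded) => [_ ? ? v|_ ? ? v].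
  by rewrite mulmxA.
by rewrite scalemxAr.
Qed.

Lemma opnorm0 : opnorm 0 = 0.
Proof. by rewrite -(scale0r 0) opnormZ normc0 mul0r. Qed.

Lemma opnorm_le_entries A : opnorm A <= \sum_i \sum_j normc (A i j).
Proof. by apply: (repnorm_le (inhabits tt)) => _ v v1; exact: dnorm_mulmx. Qed.

Lemma opnorm_ub A v : dnorm (vdot R n) v <= 1 -> dnorm (vdot R n) (A *m v) <= opnorm A.
Proof.
exact: (@le_repnorm1 R M unit _ (fun=> vdot R n) (fun _ B v => B *m v) opbounded A tt).
Qed.

Lemma opnorm_dist A B : `|opnorm A - opnorm B| <= opnorm (A - B).
Proof.
have leAB := opnormD (A - B) B; have leBA := opnormD (- (A - B)) A.
rewrite subrK in leAB; rewrite opprB subrK -opprB opnormN in leBA.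
rewrite ler_norml; move: (opnorm (A - B)) (opnorm A) (opnorm B) leAB leBA.
by move=> c a b *; apply/andP; split; lra.
Qed.
End OperatorNorm.

Section ConePaths.
Variables (R : realType) (n : nat).

(** Continuity is known entry by entry; the variation of the norm is bounded by the sum [g] of the
    variations of the entries. *)
Lemma cone_opnorm_continuous (f : cone R n) :
  {within `[0, 1], continuous (fun t => opnorm (cone_at f t))}.
Proof.
have [fc _] := subvalP f.
move=> x; apply/cvgrPdist_lt => e e0.
pose g (t : R) : R := \sum_i \sum_j
  (`|complex.Re (cone_at f t i j) - complex.Re (cone_at f x i j)|
   + `|complex.Im (cone_at f t i j) - complex.Im (cone_at f x i j)|).
have gc : {within `[0, 1], continuous g}.
  move=> y; apply: cvg_big => [|i _]; first exact: add_continuous.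
  apply: cvg_big => [|j _]; first exact: add_continuous.
  have [c1 c2] := fc i j.
  apply: cvgD; apply: cvg_norm; apply: cvgB; try exact: cvg_cst.
    exact: c1.
  exact: c2.
have gx : g x = 0.
  by rewrite /g big1// => i _; rewrite big1// => j _; rewrite !subrr !normr0 addr0.
have /cvgrPdist_lt/(_ _ e0) := gc x; apply: filterS => t.
rewrite /from_subspace gx sub0r normrN => /(le_lt_trans (ler_norm _)); apply: le_lt_trans.
rewrite distrC (le_trans (opnorm_dist _ _))// (le_trans (opnorm_le_entries _))//.
apply: ler_sum => i _; apply: ler_sum => j _; rewrite !mxE.
rewrite (le_trans (normc_le _))//.
by case: (cone_at f t i j) (cone_at f x i j) => [a b] [c d].
Qed.

Lemma cone_at_out (f : cone R n) t : ~~ (0 < t <= 1) -> cone_at f t = 0.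
Proof. by move=> t01; have [_ f0] := subvalP f; exact: f0. Qed.

Lemma cone_opnorm_le_snorm (f : cone R n) t : opnorm (cone_at f t) <= snorm f.
Proof.
(* The supremum defining [snorm] bounds its members only if they are bounded; compactness of
   [[0, 1]] ensures this. *)
have bd (a : cone R n) : exists K, forall (t : R) v,
    dnorm (vdot R n) v <= 1 -> dnorm (vdot R n) (cone_eval t a v) <= K.
  have [c _ ac] := EVT_max ler01 (cone_opnorm_continuous (f := a)).
  exists (opnorm (cone_at a c)) => u v v1; apply: le_trans (opnorm_ub _ v1) _.
  have [/andP[u0 u1]|u01] := boolP (0 < u <= 1).
    by apply: ac; rewrite in_itv /= (ltW u0).
  by rewrite (cone_at_out a u01) opnorm0; exact: opnorm_ge0.
apply: (repnorm_le (inhabits tt)) => _ v v1.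
exact: (@le_repnorm1 R (cone R n) R _ (fun=> vdot R n) (@cone_eval R n) bd f t).
Qed.

Lemma cone_snorm_le (f : cone R n) K :
  (forall t, opnorm (cone_at f t) <= K) -> snorm f <= K.
Proof.
move=> fK; apply: (repnorm_le (inhabits (0 : R))) => t v v1.
exact: le_trans (opnorm_ub _ v1) (fK t).
Qed.
End ConePaths.

Section SequencesOfCones.
Variable R : realType.
Local Notation Q := (prod_mod_sum (fun n => cone R n.+1)).
Local Notation P := (bounded_prod (fun n => cone R n.+1)).

(* The norm of the n-th term of a lifting of [q], evaluated at [t n], is
   asymptotically at most [r]. *)
Definition limsup_at (t : nat -> R) (q : Q) (r : R) :=
  exists X : P, quot_pi _ X = q /\ exists2 e : nat -> R, e @ \oo --> (0 : R) &
    forall n, opnorm (cone_at (seq_at X n) (t n)) <= r + e n.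

(** Two liftings differ by a null sequence, whose norms are absorbed into the error. *)
Lemma limsup_at_lift t (X : P) r : limsup_at t (quot_pi _ X) r ->
  exists2 e : nat -> R, e @ \oo --> (0 : R) &
    forall n, opnorm (cone_at (seq_at X n) (t n)) <= r + e n.
Proof.
move=> [Y [/esym/quotAlgE XY [e e0 Ye]]].
exists (fun n => e n + snorm (seq_at (X - Y) n)).
  by rewrite -(addr0 (0 : R)); exact: cvgD.
move=> n; rewrite addrA.
have -> : cone_at (seq_at X n) (t n)
    = cone_at (seq_at Y n) (t n) + cone_at (seq_at (X - Y) n) (t n).
  by rewrite /cone_at /= addrC subrK.
by rewrite (le_trans (opnormD _ _))// lerD// cone_opnorm_le_snorm.
Qed.

(** Hence the quadratic estimate applies to any choice of points [t n], one on each path. *)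
Lemma limsup_at_seminorm t : seminorm_bound (limsup_at t).
Proof.
split.
- exists 0; split=> //; exists (fun=> 0); first exact: cvg_cst.
  by move=> n; rewrite addr0 /cone_at /= opnorm0.
- move=> q r s rs [X [Xq [e e0 Xe]]]; exists X; split=> //; exists e => // n.
  by rewrite (le_trans (Xe n))// lerD2r.
- move=> q q' r s [X [<- [e e0 Xe]]] [Y [<- [d d0 Yd]]].
  exists (X + Y); split; first exact: quot_piD.
  exists (e \+ d); first by rewrite -(addr0 (0 : R)); exact: cvgD.
  move=> n; rewrite /= addrACA (le_trans _ (lerD (Xe n) (Yd n)))//.
  exact: opnormD.
- move=> c q r [X [<- [e e0 Xe]]]; exists (c *: X); split; first exact: quot_piZ.
  exists (fun n => normc c * e n).
    by rewrite -(mulr0 (normc c)); apply: cvgM => //; exact: cvg_cst.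
  move=> n; rewrite -mulrDr -[leLHS]/(opnorm (c *: cone_at (seq_at X n) (t n))).
  by rewrite opnormZ ler_wpM2l ?normc_ge0.
- move=> q q' r s [X [<- [e e0 Xe]]] [Y [<- [d d0 Yd]]].
  exists (amul X Y); split; first exact: quot_piM.
  exists (fun n => r * d n + e n * s + e n * d n).
    rewrite (_ : 0 = r * 0 + 0 * s + 0 * 0 :> R); last by rewrite !(mulr0, mul0r, addr0).
    by do ![apply: cvgD]; apply: cvgM => //; exact: cvg_cst.
  move=> n; rewrite (_ : r * s + _ = (r + e n) * (s + d n)); last by ring.
  rewrite (le_trans (opnormM _ _))// ler_pM ?opnorm_ge0//.
Qed.
End SequencesOfCones.

Section Rigidity.
Variables (R : realType) (G : groupType) (S : seq G).
Local Notation Q := (prod_mod_sum (fun n => cone R n.+1)).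
Variable x : G -> Q.
Hypothesis x1 : x 1%g = 0.
Hypothesis xM : forall g h, x (g * h)%g = amul (x g) (x h) + x g + x h.
Hypothesis genS : forall P : G -> Prop, P 1%g ->
  (forall s g, s \in S -> P g -> P (g * s)%g) -> forall g, P g.
Hypothesis fin_exp : forall g : G, exists2 m, (0 < m)%N & derived G (g ^+ m)%g.

Let X s := quot_repr (x s).
Let path_norm n t := \sum_(s <- S) opnorm (cone_at (seq_at (X s) n) t).

Let path_norm_ge0 n t : 0 <= path_norm n t.
Proof. by apply: sumr_ge0 => s _; exact: opnorm_ge0. Qed.

Let path_norm_ge s n t : s \in S ->
  opnorm (cone_at (seq_at (X s) n) t) <= path_norm n t.
Proof.
move=> sS; rewrite /path_norm (big_rem s)//= lerDl.
by apply: sumr_ge0 => ? _; exact: opnorm_ge0.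
Qed.

Let path_norm_out n t : ~~ (0 < t <= 1) -> path_norm n t = 0.
Proof.
by move=> t01; rewrite /path_norm big1// => s _; rewrite cone_at_out// opnorm0.
Qed.

(** Cone elements vanish at 0, so the path of norms starts at 0 and takes all intermediate values.
    Outside [(0, 1]] it is 0, which forces [c = 0]. *)
Let path_norm_ivt n t (c : R) : 0 <= c -> c <= path_norm n t ->
  exists u, path_norm n u = c.
Proof.
move=> c0 ct; have [t01|t01] := boolP (0 < t <= 1); last first.
  exists t; apply/eqP; rewrite eq_le ct andbT.
  by rewrite path_norm_out.
have [t0 t1] := andP t01.
have cont : {within `[0, t], continuous (path_norm n)}.
  have sub : [set` `[0, t]] `<=` [set` `[0, 1]] by apply: subset_itvl; rewrite bnd_simp.
  apply: (continuous_subspaceW sub) => y.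
  apply: cvg_big => [|s _]; first exact: add_continuous.
  exact: cone_opnorm_continuous.
have [|u _ uc] := IVT (ltW t0) cont (v := c); last by exists u.
by rewrite (path_norm_out n (t := 0)) ?ltxx// minEle maxEle path_norm_ge0 c0 ct.
Qed.

(* Along paths issued from [0], the norm of [x] on the generators starts at [0]
   and cannot cross the gap left by the quadratic estimate. *)
Lemma path_rigidity s : s \in S -> x s = 0.
Proof.
move=> sS; have [C C0 BC] := quadratic_estimate x1 xM genS fin_exp.
apply: contrapT => xs0.
(* A nonzero class has no null lifting: norms at least [e0] recur for arbitrarily large [n]. *)
have [e0 e0_gt0 frequently] : exists2 e : R, 0 < e &
    forall N, exists2 n, (N <= n)%N & e <= snorm (seq_at (X s) n).
  apply: contrapT => no; apply: xs0.
  rewrite -(quot_reprK (x s)) -(quot_pi0 (null_ideal _)); apply/quotAlgE.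
  rewrite subr0; apply/cvgrPdist_lt => e e_gt0.
  apply: contrapT => noN; apply: no; exists e => // N.
  apply: contrapT => noe; apply: noN; exists N => // n /= Nn.
  rewrite sub0r normrN ger0_norm ?snorm_ge0// ltNge; apply/negP => en.
  by apply: noe; exists n.
pose K := (size S)%:R * C + 1.
have K_gt0 : 0 < K by rewrite ltr_wpDl// mulr_ge0.
(* [c < e0] makes the level [c] reachable, [c <= 1] is required by [small], and [c <= 1 / (2 K)]
   brings the summed quadratic bound down to [c / 2]. *)
pose c := Num.min (e0 / 2) (Num.min 1 (2 * K)^-1).
have c_gt0 : 0 < c by rewrite !lt_min divr_gt0//= ltr01 invr_gt0 mulr_gt0.
have c1 : c <= 1 by rewrite !ge_min lexx orbT.
have ce : c < e0.
  by rewrite (@le_lt_trans _ _ (e0 / 2))// ?ge_min ?lexx// gtr_pMr// invf_lt1// ltrDl.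
have cK : (size S)%:R * (C * c ^+ 2) <= c / 2.
  have : c <= (2 * K)^-1 by rewrite !ge_min lexx !orbT.
  rewrite -[_^-1]div1r ler_pdivlMr ?mulr_gt0// => cK.
  have -> : (size S)%:R * (C * c ^+ 2) = c * (c * (K - 1)) by rewrite /K; ring.
  by rewrite ler_pM2l//; nra.
(* [t n] sits exactly at level [c] when the [n]-th norm is at least [e0], and otherwise at 0, where
   the paths vanish. *)
have /choice[t tP] n : exists t, path_norm n t <= c /\
    (e0 <= snorm (seq_at (X s) n) -> path_norm n t = c).
  have [en|ne] := leP e0 (snorm (seq_at (X s) n)); last first.
    by exists 0; rewrite path_norm_out ?ltxx// ltW.
  suff [t tc] : exists t, c <= path_norm n t.
    by have [u uc] := path_norm_ivt (ltW c_gt0) tc; exists u; rewrite uc.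
  apply: contrapT => no; have : snorm (seq_at (X s) n) <= c.
    apply: cone_snorm_le => t; apply: le_trans (path_norm_ge n t sS) _.
    by rewrite leNgt; apply/negP => /ltW ct; apply: no; exists t.
  by move=> /(le_trans en); rewrite leNgt ce.
have small_t : small x S (limsup_at t) c.
  split; [exact: limsup_at_seminorm|by rewrite ltW|move=> u uS].
  exists (X u); split; first exact: quot_reprK.
  exists (fun=> 0) => [|n]; first exact: cvg_cst.
  by rewrite addr0 (le_trans (path_norm_ge _ _ uS))//; case: (tP n).
have /choice[e eP] u : exists e : nat -> R, u \in S -> e @ \oo --> (0 : R) /\
    forall n, opnorm (cone_at (seq_at (X u) n) (t n)) <= C * c ^+ 2 + e n.
  have [uS|] := boolP (u \in S); last by exists (fun=> 0).
  have := BC _ _ small_t u uS; rewrite -(quot_reprK (x u)) => /limsup_at_lift[e e_0 eP].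
  by exists e.
pose d n := \sum_(u <- S) (if u \in S then e u n else 0).
have d0 : d @ \oo --> (0 : R).
  rewrite -[X in _ --> X](@big1 R 0 +%R _ S predT (fun=> 0))//.
  apply: cvg_big => [|u _]; first exact: add_continuous.
  by case: (boolP (u \in S)) => [/eP[]|_] //; exact: cvg_cst.
(* At the points [t n] the level is at most [c / 2] up to a null error, yet it equals [c] for
   infinitely many [n]. *)
have path_d n : path_norm n (t n) <= c / 2 + d n.
  apply: le_trans (_ : \sum_(u <- S) (C * c ^+ 2) + d n <= _); last first.
    by rewrite lerD2r big_const_seq count_predT iter_addr_0 -(mulr_natl (C * _)).
  rewrite -big_split /= /path_norm big_seq [leRHS]big_seq.
  by apply: ler_sum => u uS; rewrite uS; have [_] := eP u uS.
move/cvgrPdist_lt : d0 => /(_ (c / 2)); rewrite divr_gt0// => /(_ isT)[N _ dN].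
have [n Nn en] := frequently N.
have [_ /(_ en) tc] := tP n.
have := dN n Nn; rewrite sub0r normrN => /(le_lt_trans (ler_norm _)) dc.
have := path_d n; rewrite tc.
by move: (d n) dc => z; lra.
Qed.
End Rigidity.

(** * Group elements in the augmentation ideal *)

Section GroupElements.
Variables (R : realType) (G : groupType).
Local Notation C := (R[i]).
Local Notation T := (groupAlg R G).

Fact ga_delta_fin (g : G) : finite_set [set h | ((h == g)%:R : C) != 0].
Proof.
apply: sub_finite_set (finite_set1 g) => h /=.
by have [->|] := eqVneq h g; rewrite ?eqxx.
Qed.
Definition ga_delta g : T := GroupAlg (ga_delta_fin g).

Lemma ga_delta_sum (V : lmodType C) (F : G -> V) g :
  \sum_(h \in [set: G]) ga_delta g h *: F h = F g.
Proof.
rewrite (@fsum_supp R G V F (ga_delta g) [fset g]%fset) => [|h].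
  by rewrite big_seq_fset1 /= eqxx scale1r.
rewrite inE; apply: contraLR => hg; rewrite in_fset_set; last exact: coef_fin.
by rewrite notin_setE /= (negPf hg) eqxx.
Qed.

Lemma ga_deltaM g h : ga_delta (g * h)%g = amul (ga_delta g) (ga_delta h).
Proof.
apply: groupAlgP => y.
rewrite -[RHS]/(\sum_(z \in [set: G]) ga_delta g z * ga_delta h (z^-1 * y)%g).
rewrite (ga_delta_sum (V := C^o) (fun z => ga_delta h (z^-1 * y)%g)) /=.
by congr (_%:R); congr nat_of_bool; apply/eqP/eqP => [->|<-]; rewrite ?mulKg ?mulVKg.
Qed.

Lemma augm_delta g : augm (ga_delta g) = 1.
Proof.
rewrite -[RHS](ga_delta_sum (V := C^o) (fun=> 1) g).
by apply: eq_fsbigr => h _; rewrite -[RHS]/(_ * 1) mulr1.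
Qed.

Definition ga_diff (g : G) : T := ga_delta g - ga_delta 1%g.

Lemma augm_diff g : augm (ga_diff g) = 0.
Proof. by rewrite augmD -scaleN1r augmZ !augm_delta mulN1r subrr. Qed.

(** Expansion of [gh - 1] around 1, the source of the relation [xM] in the quadratic estimate. *)
Lemma ga_diffM g h :
  ga_diff (g * h)%g = amul (ga_diff g) (ga_diff h) + ga_diff g + ga_diff h.
Proof.
rewrite /ga_diff amulDr !amulDl !amulNl !amulNr -!ga_deltaM !mulg1 !mul1g opprK.
by rewrite -[X in X + (ga_delta h - _)]addrA [X in _ + X + _]addrACA addNr add0r subrr addr0 subrKA.
Qed.

Fact const_seq_bounded (a : T) : bounded_seq (B := fun=> T) (fun=> a).
Proof. by exists (snorm a). Qed.
Definition const_seq (a : T) : bounded_prod (fun=> T) :=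
  @SubAlg _ _ (bounded_subalg (fun=> T)) (fun=> a) (const_seq_bounded a).

Fact const_seq_cauchy (a : T) : cauchy_class (quot_pi (null_ideal _) (const_seq a)).
Proof.
exists (const_seq a) => // e e0; exists 0%N => m n _ _.
by rewrite subrr snorm0.
Qed.
Definition embed (a : T) : groupCstar R G :=
  @SubAlg _ _ (cauchy_subalg T) _ (const_seq_cauchy a).

Lemma trivial_rep_embed a : trivial_rep (embed a) = augm a.
Proof.
by apply: (trivial_repP (s := const_seq a)) => //; exact: ccvg_cst.
Qed.

Lemma embedD a b : embed (a + b) = embed a + embed b.
Proof.
apply: subval_inj; rewrite /= -quot_piD; congr quot_pi.
exact: subval_inj.
Qed.

Lemma embedM a b : embed (amul a b) = amul (embed a) (embed b).
Proof.
apply: subval_inj; rewrite /= -quot_piM; congr quot_pi.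
exact: subval_inj.
Qed.

Lemma embed_eq0 a : embed a = 0 -> snorm a = 0.
Proof.
move=> /(congr1 (@subval _ _ _)) /=; rewrite -[RHS]quot_pi0 => /quotAlgE.
rewrite subr0 => a0; have {}a0 : (fun=> snorm a) @ \oo --> (0 : R) := a0.
by rewrite -(cvg_lim (@norm_hausdorff _ _) a0) lim_cst.
Qed.

Fact aug_diff_ker g : trivial_ker (embed (ga_diff g)).
Proof. by rewrite /trivial_ker /= trivial_rep_embed augm_diff. Qed.
(** The subalgebra is spelled out because [augmentation_ideal] gives it no name. *)
Definition aug_diff g : augmentation_ideal R G :=
  @SubAlg _ _ (StarSubalg (@trivial_ker0 R G) (@trivial_kerD R G)
    (@trivial_kerZ R G) (@trivial_kerM R G) (@trivial_kerS R G)) _ (aug_diff_ker g).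

Lemma aug_diffM g h :
  aug_diff (g * h)%g = amul (aug_diff g) (aug_diff h) + aug_diff g + aug_diff h.
Proof. by apply: subval_inj; rewrite /= ga_diffM 2!embedD embedM. Qed.

Lemma aug_diff1 : aug_diff 1%g = 0.
Proof.
apply: subval_inj; rewrite /= /ga_diff subrr.
by apply: (addrI (embed 0)); rewrite -embedD !addr0.
Qed.

(** The universal norm dominates every representation, so the length of [pi(g) v - v] is at most
    that of [v] times the norm of [g - 1], which is 0. *)
Lemma rep_fixed_of_aug_diff (pi : unitaryRep R G) g (v : pi) :
  aug_diff g = 0 -> rep_act g v = v.
Proof.
move=> /(congr1 (@subval _ _ _)) /= /embed_eq0 g0.
have bd (a : T) : exists K, forall (rho : unitaryRep R G) (w : rho),
    dnorm (hilbert_ip rho) w <= 1 -> dnorm (hilbert_ip rho) (rep_eval a w) <= K.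
  exists (\sum_(h <- supp a) normc (a h)) => rho w w1; rewrite /rep_eval ga_evalE.
  elim: (enum_fset (supp a)) => [|h s IH]; first by rewrite !big_nil dnorm0.
  rewrite !big_cons (le_trans (ler_dnormD _ _ _))// lerD// dnormrZ.
  by rewrite [dnorm _ (rep_act _ _)]/dnorm rep_unitary ler_piMr ?normc_ge0.
have evZr (rho : unitaryRep R G) (c : C) a (w : rho) :
    rep_eval a (c *: w) = c *: rep_eval a w.
  apply: ga_eval_actZ; exact: rep_linear.
have := @le_repnorm R T _ _ (fun rho : unitaryRep R G => hilbert_ip rho)
  (@rep_eval R G) evZr bd (ga_diff g) pi v.
rewrite -[repnorm _ _ _]/(snorm (ga_diff g)) g0 mul0r => le0.
apply/eqP; rewrite -subr_eq0; apply/eqP/(dnorm0_eq0 (ip := hilbert_ip pi))/le_anti.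
rewrite dnormr_ge0 andbT (le_trans _ le0)//.
rewrite /rep_eval /ga_diff ga_evalD -(scaleN1r (ga_delta 1%g)) ga_evalZ scaleN1r.
by rewrite /ga_eval !ga_delta_sum rep1.
Qed.
End GroupElements.

(** * The holonomy representation, complexified to a unitary one *)

Section LinearPartRepresentation.
Variables (R : realType) (k : nat).

Fact vdot_complete (u : nat -> 'cV[R[i]]_k) :
  (forall e : R, 0 < e -> exists N, forall m n, (N <= m)%N -> (N <= n)%N ->
    dnorm (vdot R k) (u m - u n) < e) ->
  exists l, (fun n => dnorm (vdot R k) (u n - l)) @ \oo --> (0 : R).
Proof.
move=> uc; have ccv i : ccvg (fun n => u n i 0) (clim (fun n => u n i 0)).
  apply: ccauchy_cvg => e /uc[N uN]; exists N => m n Nm Nn.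
  apply: le_lt_trans (uN m n Nm Nn).
  by have := vdot_coord (u m - u n) i; rewrite !mxE.
pose l : 'cV[R[i]]_k := \col_i clim (fun n => u n i 0); exists l.
have sum0 : (fun n => \sum_i normc (u n i 0 - l i 0)) @ \oo --> (0 : R).
  rewrite -[X in _ --> X](@big1 R 0 +%R _ (index_enum 'I_k) predT (fun=> 0))//.
  apply: cvg_big => [|i _]; first exact: add_continuous.
  by rewrite mxE; apply/ccvgP.
apply: (squeeze_cvgr _ (cvg_cst 0) sum0); apply: nearW => n.
rewrite dnormr_ge0 (le_trans (vdot_norm_le_sum _))//.
by apply: ler_sum => i _; rewrite !mxE.
Qed.
Definition vhilbert : hilbertType R := Hilbert vdot_complete.

Variables (G : groupType) (phi : G -> euclid R k).
Hypothesis phiM : {morph phi : g h / (g * h)%g}.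

Lemma euclid_morph1 : phi 1%g = 1%g.
Proof. by apply: (mulgI (phi 1%g)); rewrite -phiM !mulg1. Qed.

Definition linpart_act (g : G) (v : vhilbert) : vhilbert :=
  cplx (linpart (phi g)) *m v.
Fact linpart_act_linear g : linear (linpart_act g).
Proof. by move=> c u v; rewrite /linpart_act mulmxDr scalemxAr. Qed.
Fact linpart_act1 v : linpart_act 1%g v = v.
Proof. by rewrite /linpart_act euclid_morph1 /cplx map_mx1 mul1mx. Qed.
Fact linpart_actM g h v : linpart_act (g * h)%g v = linpart_act g (linpart_act h v).
Proof. by rewrite /linpart_act phiM /cplx map_mxM mulmxA. Qed.
Fact linpart_act_unitary g (u v : vhilbert) :
  hilbert_ip vhilbert (linpart_act g u) (linpart_act g v) = hilbert_ip vhilbert u v.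
Proof. by apply: cplx_orth_vdot; exact: linpart_orth. Qed.
Definition linpart_rep : unitaryRep R G :=
  UnitaryRep linpart_act_linear linpart_act1 linpart_actM linpart_act_unitary.

Lemma linpart_of_fixed g :
  (forall v : linpart_rep, rep_act g v = v) -> linpart (phi g) = 1%:M.
Proof.
move=> fixg; apply/matrixP => i j; apply: (@complexI R).
have := congr1 (fun w : 'cV[R[i]]_k => w i 0) (fixg (delta_mx j 0)).
by rewrite /= /linpart_act -colE !mxE eqxx andbT => ->; rewrite rmorph_nat.
Qed.
End LinearPartRepresentation.

(** * Finite generation of [G] through its embedding *)

Section FiniteGeneration.
Variables (R : realType) (G : groupType) (k : nat) (H : groupClosed (euclid R k)).
Variable phi : G -> euclid R k.
Hypothesis phiM : {morph phi : g h / (g * h)%g}.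
Hypothesis phi_inj : injective phi.
Hypothesis phi_range : range phi = [set` H].
Hypothesis crystH : crystallographic H.

(** [S] lists the preimages of the elements of [H] with short translation part, finite in number by
    discreteness. *)
Lemma crystallographic_fg : exists S : seq G, forall P : G -> Prop, P 1%g ->
  (forall s g, s \in S -> P g -> P (g * s)%g) -> forall g, P g.
Proof.
have [r genH] := crystallographic_generated crystH.
have phi_in g : phi g \in H.
  by suff : [set` H] (phi g) by []; rewrite -phi_range; exists g.
have iso1 : isolated [set` H] (1%g : euclid R k) by apply: crystH.1; exact: gpred1.
have /(finite_preimage (f := phi) (fun _ _ _ _ => @phi_inj _ _)) :=
  discrete_locally_finite r iso1.
move=> /finite_seqP[S SE]; exists S => P P1 PM g.
(* The induction runs in [H], so the predicate is transported to preimages under [phi]. *)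
suff : forall h, h \in H -> forall g, phi g = h -> P g by move/(_ _ (phi_in g)); apply.
apply: genH => [g' g'1|s h sH sr IH g' g'E].
  suff -> : g' = 1%g by [].
  by apply: phi_inj; rewrite g'1 (euclid_morph1 phiM).
have [s' _ s'E] : range phi s by rewrite phi_range.
rewrite -(mulgVK s' g'); apply: PM.
  have : (phi @^-1` [set h | h \in H /\ enorm (translation h) <= r]) s'.
    by rewrite /preimage /mkset s'E.
  by rewrite SE.
apply: IH; apply: (mulIg s).
by rewrite -{1}s'E -phiM mulgVK.
Qed.
End FiniteGeneration.

Theorem theorem1p1 (R : realType) (G : groupType) :
  bieberbach R G -> finite_set (H1 G) -> ~ connective_group R G.
Proof.
move=> [tfG [k [k0 [H [crystH [phi [phiM phi_inj phi_range]]]]]]] finH1 [f f_inj].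
have [S genS] := crystallographic_fg phiM phi_inj phi_range crystH.
have fin_exp g := derived_exponent g finH1.
have fD a b : f (a + b) = f a + f b.
  by have := starhom_linear f 1 a b; rewrite !scale1r.
have f0 : f 0 = 0 by apply: (addrI (f 0)); rewrite -fD !addr0.
pose x g := f (aug_diff R g).
have x1 : x 1%g = 0 by rewrite /x aug_diff1.
have xM g h : x (g * h)%g = amul (x g) (x h) + x g + x h.
  by rewrite /x aug_diffM !fD starhomM.
(* Rigidity kills [f (s - 1)], injectivity then kills [s - 1], and so [s] acts trivially in the
   holonomy representation. *)
have linS s : s \in S -> linpart (phi s) = 1%:M.
  move=> sS; apply: (linpart_of_fixed (phiM := phiM)) => v.
  apply: rep_fixed_of_aug_diff; apply: f_inj; rewrite f0.
  exact: (path_rigidity x1 xM genS fin_exp sS).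
have lin1 g : linpart (phi g) = 1%:M.
  elim/genS: g => [|s g sS g1]; first by rewrite (euclid_morph1 phiM).
  by rewrite phiM linpartM g1 linS// mulmx1.
(* Isometries with trivial linear part are translations, which commute. *)
have commG (g h : G) : (g * h = h * g)%g.
  apply: phi_inj; rewrite !phiM; apply: euclidP; last by rewrite !linpartM !lin1.
  by rewrite !translationM !lin1 !mul1mx addrC.
(* In an abelian group the derived subgroup is trivial, so [g] has finite order and torsion-freeness
   applies. *)
have G1 (g : G) : g = 1%g.
  have [m m0 Dg] := fin_exp g; apply: (tfG g m m0); move: (g ^+ m)%g Dg.
  apply: (@derived_ind G (fun y => y = 1%g)) => // [a b -> ->|a ->|a b]; rewrite ?mulg1 ?invg1//.
  by rewrite /commg /conjg (commG a b) mulKg mulVg.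
(* The trivial group is not cocompact: the translation by [v] moves the origin by [|r|], which is
   not less than [r]; [k0] provides the coordinate. *)
have [r dense] := cocompact_dense crystH.2.
pose v : 'cV[R]_k := r *: delta_mx (Ordinal k0) 0.
have [h hH] := dense (pure_translation v).
have [g _ <-] : range phi h by rewrite phi_range.
rewrite (G1 g) (euclid_morph1 phiM) mulg1 /= enormZ /enorm /cplx map_delta_mx dnorm_delta.
by rewrite mulr1 ltNge ler_norm.
Qed.
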